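(* Let $V$ be a $2$-dimensional real vector space. Then $$\mathcal{V}(B)=\omega_2=\pi$$ for every unit ball $B\subset V$ of a norm. In particular, on every finite-dimensional normed space of dimension at least $2$, the $2$-volume density induced by (the definition of volume with associated affine invariant) $\mathcal{V}$ is Busemann's $2$-volume density.
   Context: $\omega_n$ is the volume of the Euclidean unit ball in $\mathbb{R}^n$ ($\omega_1=2$, $\omega_2=\pi$). For an $n$-dimensional vector space $V$, $n\ge2$, and the unit ball $B$ of a norm on $V$, $$\mathcal{V}(B):=\frac{\omega_n^{n-1}}{\omega_{n-1}^n}\sup_{L}\{\mathrm{svol}(B\times\Pi L):V_1(L,B)=1\},$$ where $L$ ranges over all non-empty compact convex subsets of $V$; in particular, for $n=2$ the prefactor is $\pi/4$. Here one fixes a volume form $\Omega$ on $V$ with Lebesgue measure $\mathrm{vol}$; $\mathrm{svol}=\mathrm{vol}\times\mathrm{vol}^*$ on $V\times V^*$ with $\mathrm{vol}^*$ the dual Lebesgue measure; $V_1(L,B)=V(L,\dots,L,B)$ ($n-1$ copies of $L$) is the mixed volume; the projection body $\Pi L\subset V^*$ is the convex body with support function $h(\Pi L,v)=\sup_{\xi \in \Pi L} \langle \xi,v\rangle$ equal to the volume of the image of $L$ in $V/\mathbb{R}v$ with respect to $\Omega(v,\cdot)$, $0\ne v\in V$. The value $\mathcal V(B)$ is independent of $\Omega$. A functional $\mathcal{V}$ of this kind (an associated affine invariant) gives a definition of volume $\mu$: for a normed space $W$ of dimension $m$ with unit ball $B_W$, $\mu_W(v_1\wedge\dots\wedge v_m)=\frac{\mathcal{V}(B_W)}{\mathrm{vol}(B_W)}\mathrm{vol}(P)$,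 with $P$ the parallelotope spanned by $v_1,\dots,v_m$. The induced $2$-volume density on a normed space is the function on simple $2$-vectors $\mu_2(a)=\mu_{\langle a\rangle}(a)$ ($a\neq0$), where $\langle a\rangle$ is the plane spanned by $a$ with the induced norm. Busemann's definition of volume is the one with associated affine invariant $\mathcal{V}^b(B)\equiv\omega_n$ in dimension $n$, and Busemann's $2$-volume density is the $2$-volume density it induces. *)

(* Defs.v *)
From HB Require Import structures.
From mathcomp Require Import all_boot all_order all_algebra.
From mathcomp Require Import all_classical all_reals all_analysis.

Set Implicit Arguments.
Unset Strict Implicit.
Unset Printing Implicit Defensive.

Import Order.TTheory GRing.Theory Num.Theory.
Import numFieldNormedType.Exports.

Local Open Scope classical_set_scope.
Local Open Scope ring_scope.

(** n-dimensional Lebesgue measure, as an iterated integral: it is the n-fold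
    product of [lebesgue_measure] on Borel sets, to which it is only applied
    (in fact only to compact sets). *)
Fixpoint lebesgue_rV (R : realType) (n : nat) : set 'rV[R]_n -> \bar R :=
  match n return set 'rV[R]_n -> \bar R with
  | 0 => fun A => (\1_A 0)%:E
  | m.+1 => fun A =>
      (\int[@lebesgue_measure R]_x
         lebesgue_rV [set y : 'rV[R]_m |
                        A (row_mx (x%:M : 'rV[R]_1) y : 'rV[R]_(1 + m))])%E
  end.

Definition omega (R : realType) (n : nat) : R :=
  fine (lebesgue_rV [set x : 'rV[R]_n | \sum_(i < n) x 0 i ^+ 2 <= 1]).

Section FiniteDimensional.
Context {R : realType}.
Implicit Types (n : nat) (U V : vectType R).

Definition basis_vec U (i : nat) : U := (vbasis {:U})`_i.

(** When n is the dimension of U, the linear isomorphism R^n -> U given by a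
    basis of U. *)
Definition of_coords n U (x : 'rV[R]_n) : U :=
  \sum_(i < n) x 0 i *: basis_vec U i.

(** Compactness for the unique Hausdorff vector topology of U. *)
Definition compact_in U (L : set U) : Prop :=
  compact (@of_coords (\dim {:U}) U @^-1` L).

(** Compact convex sets; the interior may be empty. *)
Definition convex_body U (L : set U) : Prop :=
  [/\ L !=set0, compact_in L & convex_set (L : set (convex_lmodType U))].

Definition is_norm U (N : U -> R) : Prop :=
  [/\ forall x, N x = 0 -> x = 0,
      forall (a : R) x, N (a *: x) = `|a| * N x &
      forall x y, N (x + y) <= N x + N y].

Definition unit_ball U (N : U -> R) : set U := [set x | N x <= 1].

Definition update n U (v : 'I_n -> U) (i : 'I_n) (x : U) : 'I_n -> U :=
  fun j => if j == i then x else v j.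

(** Nonzero alternating n-linear forms; these are the volume forms of U when
    \dim {:U} = n. *)
Definition volume_form n U (Om : ('I_n -> U) -> R) : Prop :=
  [/\ forall v i (a : R) x y,
        Om (update v i (a *: x + y)) =
        a * Om (update v i x) + Om (update v i y),
      forall v i j, i != j -> v i = v j -> Om v = 0 &
      exists v, Om v != 0].

(** The functions below are meant for \dim {:U} = n (resp. n.+1), where n is
    the arity of the form Om. *)

(** The Lebesgue measure giving the parallelotope spanned by v_1, ..., v_n the
    measure |Om(v_1, ..., v_n)|. *)
Definition vol n U (Om : ('I_n -> U) -> R) (A : set U) : R :=
  `|Om (basis_vec U)| * fine (lebesgue_rV (@of_coords n U @^-1` A)).

Definition dual_space U : vectType R := 'Hom(U, R^o).

(** The dual Lebesgue measure, computed in the coordinates f |-> (f b_i)_i of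
    the dual space with respect to the basis dual to (b_i). *)
Definition dual_vol n U (Om : ('I_n -> U) -> R) (A : set (dual_space U)) : R :=
  `|Om (basis_vec U)|^-1 *
  fine (lebesgue_rV [set x : 'rV[R]_n |
          exists2 f : dual_space U,
            A f & forall i : 'I_n, f (basis_vec U i) = x 0 i]).

(** vol x vol* on the product A x A'. *)
Definition svol n U (Om : ('I_n -> U) -> R)
    (A : set U) (A' : set (dual_space U)) : R :=
  vol Om A * dual_vol Om A'.

(** The Minkowski sum of the K i, i \in S. *)
Definition minkowski_sum n U (K : 'I_n -> set U) (S : {set 'I_n}) : set U :=
  [set x | exists2 y : 'I_n -> U,
             (forall i, i \in S -> K i (y i)) & x = \sum_(i in S) y i].

(** V(K_1, ..., K_n), by polarization of the volume. *)
Definition mixed_volume n U (Om : ('I_n -> U) -> R) (K : 'I_n -> set U) : R :=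
  (n`!%:R)^-1 *
  \sum_(S : {set 'I_n} | S != finset.set0)
     (-1) ^+ (n - #|S|) * vol Om (minkowski_sum K S).

(** V(L, ..., L, B), with n copies of L in dimension n.+1. *)
Definition mixed_volume1 n U (Om : ('I_n.+1 -> U) -> R) (L B : set U) : R :=
  mixed_volume Om (fun i => if i == ord_max then B else L).

(** For v != 0, the quotient U / R v is represented by a complement of the line
    spanned by v; [contract] is then the form Om(v, .) on the quotient, and
    [quotient_image] the image of L in the quotient. *)
Definition quotient_line U (v : U) : vectType R := subvs_of (<[v]>^C)%VS.

Definition contract n U (Om : ('I_n.+1 -> U) -> R) (v : U) :
    ('I_n -> quotient_line v) -> R :=
  fun u => Om (fun i => if unlift ord0 i is Some j then vsval (u j) else v).

Definition quotient_image U (v : U) (L : set U) : set (quotient_line v) :=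
  [set q | exists t : R, L (vsval q + t *: v)].

Arguments contract {n U} Om v _.
Arguments quotient_image {U} v L _.

Definition is_projection_body n U (Om : ('I_n.+1 -> U) -> R) (L : set U)
    (P : set (dual_space U)) : Prop :=
  convex_body P /\
  forall v, v != 0 ->
    sup [set f v | f in P] = vol (contract Om v) (quotient_image v L).

(** The functionals from which definitions of volume are built; the dimension
    of U is n.+1. *)
Definition volume_functional : Type :=
  forall n U (Om : ('I_n.+1 -> U) -> R) (B : set U), \bar R.

Definition calV : volume_functional := fun n U Om B =>
  ((omega R n.+1 ^+ n / omega R n ^+ n.+1)%:E *
   ereal_sup [set s%:E | s in
     [set s : R | exists L P,
        [/\ convex_body L, mixed_volume1 Om L B = 1%R,
            is_projection_body Om L P & s = svol Om B P]]])%E.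

Definition busemann : volume_functional := fun n _ _ _ => (omega R n.+1)%:E.

Definition parallelotope n U (v : 'I_n -> U) : set U :=
  [set x | exists2 t : 'I_n -> R,
             (forall i, 0 <= t i <= 1) & x = \sum_(i < n) t i *: v i].

(** mu_U (v_1 /\ ... /\ v_m), with m = n.+1, for the definition of volume mu
    associated with F. *)
Definition volume_of (F : volume_functional) n U (Om : ('I_n.+1 -> U) -> R)
    (N : U -> R) (v : 'I_n.+1 -> U) : R :=
  fine (F n U Om (unit_ball N)) / vol Om (unit_ball N) *
  vol Om (parallelotope v).

(** 2-vectors of U as bilinear forms on the dual space. *)
Definition wedge U (v w : U) : dual_space U -> dual_space U -> R :=
  fun f g => f v * g w - f w * g v.

(** Some (v, w) with a = v /\ w, for a simple 2-vector a. *)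
Definition factors U (a : dual_space U -> dual_space U -> R) : U * U :=
  xget (0, 0) [set p | a = wedge p.1 p.2].

Definition span2 U (a : dual_space U -> dual_space U -> R) : {vspace U} :=
  <<[:: (factors a).1; (factors a).2]>>%VS.

(** The 2-volume density induced by F: mu_2(a) = mu_<a>(a), and mu_2(0) = 0.
    Om chooses a volume form on each plane. *)
Definition density2 (F : volume_functional) U
    (Om : forall P : {vspace U}, ('I_2 -> subvs_of P) -> R) (N : U -> R)
    (a : dual_space U -> dual_space U -> R) : R :=
  if `[< a = wedge 0 0 >] then 0 else
  volume_of F (Om (span2 a)) (fun x => N (vsval x))
    (fun i => vsproj (span2 a)
       (if i == ord0 then (factors a).1 else (factors a).2)).

End FiniteDimensional.

(* Main.v *)
Require Import Defs.
From HB Require Import structures.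
From mathcomp Require Import all_boot all_order all_algebra.
From mathcomp Require Import all_classical all_reals all_analysis.
From mathcomp Require Import measurable_realfun ring lra.

Set Implicit Arguments.
Unset Strict Implicit.
Unset Printing Implicit Defensive.

Import Order.TTheory GRing.Theory Num.Theory.
Import numFieldNormedType.Exports.

Local Open Scope classical_set_scope.
Local Open Scope ring_scope.

(** The projection body of [L] is [L - L] turned by the volume form, so the
    quantity to maximize is [vol B * vol (L - L)] under the constraint
    [V(L, B) = 1].  As [B] is symmetric, [V(L - L, B) = 2 V(L, B)], and
    Minkowski's inequality [V(K, B)^2 >= vol K * vol B] for [K = L - L] gives
    the upper bound 4, attained by a multiple of [B].

    Adding a segment to a planar body changes its area by a multiple of a width,
    so the mixed area with a zonogon is a sum of widths, hence additive and
    homogeneous in the body.  The general case follows by inscribing zonogons in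
    [B]: a polygon with vertices on equally spaced vertical lines contains the
    image of [B] under a linear map that tends to the identity. *)

(** The mixed area is defined by polarization, a formula that shows neither additivity nor
    homogeneity in one body. Both are needed: homogeneity to rescale a body before comparing it with
    another, additivity for [V(L - L, B) = 2 V(L, B)]. They are manifest for sums of widths, whence
    zonogons as second argument. The symmetry of both bodies centres their projections to an axis,
    so one dilation makes the two projections equal; comparing lengths of parallel sections and
    completing a square then yields Minkowski's inequality, without the general Brunn-Minkowski
    theorem. The passage from zonogons [Z] to [B] avoids continuity of mixed areas: for [Z] inside
    [B], the area of [K + Z] is at most that of [K + B], so twice the mixed area of [K] and [Z]
    exceeds that of [K] and [B] by at most [area B - area Z]. Only this loss of area has to tend to
    0, and a linear image of [B] inside [Z] with determinant close to 1 controls it, whatever the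
    regularity of the boundary. *)

(** * Affine substitutions on the line and measurability of planar sets *)

Section Measure.
Context {R : realType}.
Implicit Types (A : set (R * R)) (a b c : R).

Notation mu := (@lebesgue_measure R).

Lemma measurable_affine a b :
  measurable_fun [set: measurableTypeR R] (fun x => a * x + b : measurableTypeR R).
Proof. by apply: measurable_funD => //; exact: measurable_funM. Qed.

(** The right-hand side is a measure in [S], so by uniqueness of Lebesgue measure it suffices to
    compare both sides on half-open intervals. *)
Lemma lebesgue_measure_affine a b (S : set (measurableTypeR R)) : a != 0 ->
  measurable S ->
  mu S = (`|a|%:E * mu ((fun x => a * x + b)%R @^-1` S))%E.
Proof.
move=> a0 mS; have mf := measurable_affine a b.
pose phi : measurableTypeR R -> measurableTypeR R := fun x => a * x + b.
pose k : {nonneg R} := NngNum (normr_ge0 a).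
rewrite (lebesgue_measure_unique (mu := mscale k (pushforward mu phi))) //.
move=> X [[x y]] _ <-; rewrite /= /mscale /pushforward /=.
rewrite lebesgue_measure_itv /= lte_fin.
have [apos|aneg|/eqP] := ltgtP 0 a; last by rewrite eq_sym (negPf a0).
- rewrite [X in (_ * X)%E](_ : _ = mu `](x - b) / a, (y - b) / a]%classic); last first.
    apply: (congr1 mu).
    apply/seteqP; split => z; rewrite /phi /= !in_itv /= => /andP[h1 h2].
      by rewrite ltr_pdivrMr// ler_pdivlMr// !(mulrC z); apply/andP; split; lra.
    move: h1 h2; rewrite ltr_pdivrMr// ler_pdivlMr// !(mulrC z) => h1 h2.
    by apply/andP; split; lra.
  rewrite lebesgue_measure_itv /= lte_fin ltr_pM2r ?invr_gt0// ltrD2r.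
  case: ifP => _; last by rewrite mule0.
  by rewrite -!EFinD -EFinM gtr0_norm//; congr EFin; field; lra.
(* A negative slope exchanges the open and the closed end. *)
- rewrite [X in (_ * X)%E](_ : _ = mu `[(y - b) / a, (x - b) / a[%classic); last first.
    apply: (congr1 mu).
    apply/seteqP; split => z; rewrite /phi /= !in_itv /= => /andP[h1 h2].
      by rewrite ltr_ndivlMr// ler_ndivrMr// !(mulrC z); apply/andP; split; lra.
    move: h1 h2; rewrite ltr_ndivlMr// ler_ndivrMr// !(mulrC z) => h1 h2.
    by apply/andP; split; lra.
  rewrite lebesgue_measure_itv /= lte_fin ltr_nM2r ?invr_lt0// ltrD2r.
  case: ifP => _; last by rewrite mule0.
  by rewrite -!EFinD -EFinM ltr0_norm//; congr EFin; field; lra.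
Qed.

Lemma ge0_integral_affine a b (f : R -> \bar R) : a != 0 ->
  measurable_fun [set: measurableTypeR R] f -> (forall x, 0 <= f x)%E ->
  (\int[mu]_x f x = `|a|%:E * \int[mu]_x f (a * x + b)%R)%E.
Proof.
move=> a0 mf f0.
pose phi : measurableTypeR R -> measurableTypeR R := fun x => a * x + b.
have mphi : measurable_fun setT phi by exact: measurable_affine.
pose k : {nonneg R} := NngNum (normr_ge0 a).
pose nu : {measure set (measurableTypeR R) -> \bar R} :=
  mscale k (pushforward mu phi).
transitivity (\int[nu mphi]_x f x)%E.
  apply: eq_measure_integral => S mS _.
  exact: (lebesgue_measure_affine b a0 mS).
by rewrite /nu ge0_integral_mscale// ge0_integral_pushforward// preimage_setT.
Qed.

(** The product sigma-algebra is generated by rectangles, so an open set is written as a countable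
    union of them: the boxes with rational centre and radius [1 / (n + 1)] that it contains. *)
Lemma open_measurable_prod A : open A ->
  measurable (A : set (measurableTypeR R * measurableTypeR R)).
Proof.
move=> oA.
pose box (i : rat * rat * nat) : set (measurableTypeR R * measurableTypeR R) :=
  ball (ratr i.1.1 : R) i.2.+1%:R^-1 `*` ball (ratr i.1.2 : R) i.2.+1%:R^-1.
rewrite (_ : (A : set _) = \bigcup_i (if `[< box i `<=` A >] then box i else set0)).
  apply: countable_bigcupT_measurable => // i.
  case: ifP => // _; apply: measurableX; exact: measurable_ball.
apply/seteqP; split => [z Az|z [i _]]; last by case: asboolP => // bA zb; exact: bA.
have /nbhs_ballP [e /= e0 eA] : nbhs z A by exact: open_nbhs_nbhs.
have [n ne] : exists n : nat, n.+1%:R^-1 < e / 2.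
  have /ltr_add_invr[n] : 0 < e / 2 by rewrite divr_gt0.
  by rewrite add0r => ?; exists n.
have [d dE] : exists d : R, d = n.+1%:R^-1 by eexists.
rewrite -dE in ne.
have near (x : R) : exists q : rat, ball (ratr q : R) d x.
  have /rat_in_itvoo[q qx] : x - d < x + d.
    by rewrite ltrD2l gtrN// dE invr_gt0.
  exists q; rewrite -ball_normE /= ltr_distl; move: qx; rewrite in_itv/= => /andP[h1 h2].
  by rewrite h1 h2.
have [p px] := near z.1; have [q qx] := near z.2.
exists (p, q, n) => //; rewrite ifT; first by rewrite /box -dE.
apply/asboolP => w; rewrite /box -dE => -[wp wq].
apply: eA; split; rewrite /= -ball_normE /=.
  have : ball z.1 (d + d) w.1 by apply: ball_triangle wp; exact: ball_sym.
  by rewrite -ball_normE /= => /lt_trans; apply; lra.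
have : ball z.2 (d + d) w.2 by apply: ball_triangle wq; exact: ball_sym.
by rewrite -ball_normE /= => /lt_trans; apply; lra.
Qed.

Lemma closed_measurable_prod A : closed A ->
  measurable (A : set (measurableTypeR R * measurableTypeR R)).
Proof.
by move=> cA; rewrite -(setCK A); apply: measurableC; apply: open_measurable_prod;
  exact: closed_openC.
Qed.

End Measure.

(** * Planar convex bodies, their sections and their linear images *)

Section Bodies.
Context {R : realType}.
Implicit Types (A K L : set (R * R)) (S : set R) (p q : R).

Notation mu := (@lebesgue_measure R).

Definition area A : R := fine ((mu \x mu)%E A).

Definition section_at A (x : R) : set R := [set y | A (x, y)].

Definition convex_plane A : Prop := forall x y (t : R), A x -> A y -> 0 <= t <= 1 ->
  A (t * x.1 + (1 - t) * y.1, t * x.2 + (1 - t) * y.2).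

(** Points and segments are included, as the sets [L] in the supremum may have empty interior. *)
Definition body K : Prop := [/\ K !=set0, compact K & convex_plane K].

Definition lmap (a b c d : R) (z : R * R) : R * R :=
  (a * z.1 + b * z.2, c * z.1 + d * z.2).

Definition msum K L : set (R * R) :=
  [set z | exists x y, [/\ K x, L y & z = (x.1 + y.1, x.2 + y.2)]].

Definition pairing p q (z : R * R) : R := p * z.1 + q * z.2.

(** The covector is not normalized, so a width already carries the length of the segment it is
    paired with. *)
Definition width p q K : R := sup (pairing p q @` K) - inf (pairing p q @` K).

Lemma continuous_fst : continuous (fst : R * R -> R).
Proof. by move=> z; exact: cvg_fst. Qed.

Lemma continuous_snd : continuous (snd : R * R -> R).
Proof. by move=> z; exact: cvg_snd. Qed.

Lemma continuous_pairing p q : continuous (pairing p q).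
Proof.
move=> z; apply: cvgD; apply: cvgM; [exact: cvg_cst|exact: cvg_fst|exact: cvg_cst|exact: cvg_snd].
Qed.

Lemma continuous_pair (T U V : topologicalType) (f : T -> U) (g : T -> V) :
  continuous f -> continuous g -> continuous (fun z => (f z, g z)).
Proof.
by move=> cf cg z; exact: (@cvg_pair _ _ _ (nbhs z) (nbhs _) (nbhs _) _ _ _ _ _ (cf z) (cg z)).
Qed.

Lemma continuous_lmap a b c d : continuous (lmap a b c d).
Proof.
by apply: continuous_pair; exact: continuous_pairing.
Qed.

Lemma compact_image (T U : topologicalType) (f : T -> U) (C : set T) :
  continuous f -> compact C -> compact (f @` C).
Proof. by move=> cf; apply: continuous_compact; exact: continuous_subspaceT. Qed.

Lemma body_closed K : body K -> closed K.
Proof. by move=> [_ cK _]; apply: compact_closed cK; exact: norm_hausdorff. Qed.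

Lemma body_lmap a b c d K : body K -> body (lmap a b c d @` K).
Proof.
move=> [[k Kk] cK vK]; split; first by exists (lmap a b c d k), k.
  by apply: compact_image cK; exact: continuous_lmap.
move=> _ _ t [x Kx <-] [y Ky <-] t01.
by eexists; [exact: vK Kx Ky t01|]; rewrite /lmap /=; congr pair; ring.
Qed.

Lemma body_msum K L : body K -> body L -> body (msum K L).
Proof.
move=> [[k Kk] cK vK] [[l Ll] cL vL]; split.
- by exists (k.1 + l.1, k.2 + l.2), k, l.
- rewrite (_ : msum K L = (fun u : (R * R) * (R * R) => u.1 + u.2) @` (K `*` L)).
    apply: compact_image (compact_setX cK cL) => u.
    by apply: cvgD; [exact: cvg_fst|exact: cvg_snd].
  apply/seteqP; split => [z [x [y [Kx Ly ->]]]|_ [[x y] [/= Kx Ly] <-]].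
    by exists (x, y).
  by exists x, y.
- move=> _ _ t [x [y [Kx Ly ->]]] [x' [y' [Kx' Ly' ->]]] t01 /=.
  exists (t * x.1 + (1 - t) * x'.1, t * x.2 + (1 - t) * x'.2).
  exists (t * y.1 + (1 - t) * y'.1, t * y.2 + (1 - t) * y'.2).
  by split; [exact: vK|exact: vL|congr pair => /=; ring].
Qed.

Lemma msumA K L A : msum K (msum L A) = msum (msum K L) A.
Proof.
apply/seteqP; split => [_ [x [_ [Kx [y [z [Ly Az ->]]] ->]]]|_ [_ [z [[x [y [Kx Ly ->]]] Az ->]]]].
  by exists (x.1 + y.1, x.2 + y.2), z; split; [exists x, y|by []|rewrite /= !addrA].
by exists x, (y.1 + z.1, y.2 + z.2); split; [by []|exists y, z|rewrite /= !addrA].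
Qed.

Lemma subset_msum K L A A' : K `<=` A -> L `<=` A' -> msum K L `<=` msum A A'.
Proof. by move=> KA LA _ [x [y [/KA Kx /LA Ly ->]]]; exists x, y. Qed.

Lemma lmap_msum a b c d K L :
  lmap a b c d @` msum K L = msum (lmap a b c d @` K) (lmap a b c d @` L).
Proof.
apply/seteqP; split => [_ [_ [x [y [Kx Ly ->]]] <-]|_ [_ [_ [[x Kx <-] [y Ly <-] ->]]]].
  exists (lmap a b c d x), (lmap a b c d y); split; [by exists x|by exists y|].
  by rewrite /lmap /=; congr pair; ring.
exists (x.1 + y.1, x.2 + y.2); first by exists x, y.
by rewrite /lmap /=; congr pair; ring.
Qed.

Lemma lmap_comp a b c d a' b' c' d' z :
  lmap a b c d (lmap a' b' c' d' z) =
  lmap (a * a' + b * c') (a * b' + b * d') (c * a' + d * c') (c * b' + d * d') z.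
Proof. by rewrite /lmap /=; congr pair; ring. Qed.

Lemma lmap1 z : lmap 1 0 0 1 z = z.
Proof. by case: z => x y; rewrite /lmap /=; congr pair; ring. Qed.

Lemma compact_interval S : S !=set0 -> compact S ->
  (forall x y z, S x -> S y -> x <= z <= y -> S z) ->
  exists2 i, i.1 <= i.2 & S = `[i.1, i.2]%classic.
Proof.
move=> S0 cS vS.
have cid : {within S, continuous (id : R -> R)} by apply: continuous_subspaceT => x; exact: cvg_id.
have [m /set_mem Sm mS] := compact_EVT_min S0 cS cid.
have [M /set_mem SM MS] := compact_EVT_max S0 cS cid.
exists (m, M) => /=; first by apply: mS; rewrite inE.
apply/seteqP; split => [x Sx|x]; rewrite /= in_itv /=; last exact: vS.
by rewrite mS ?MS ?inE.
Qed.

Lemma lebesgue_measure_segment (a b : R) : a <= b ->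
  mu `[a, b]%classic = (b - a)%:E.
Proof.
move=> ab; rewrite lebesgue_measure_itv /= lte_fin; case: ltP => // ba.
by rewrite (@le_anti _ _ a b) ?subrr// ab ba.
Qed.

(** The quotient is the weight of [x] when [z] is written as a convex combination of [x] and [y]. *)
Lemma ratio_in01 (x y z : R) : x <= z <= y -> x < y -> 0 <= (y - z) / (y - x) <= 1.
Proof.
move=> /andP[xz zy] xy; have pos : 0 < y - x by rewrite subr_gt0.
by rewrite divr_ge0 ?subr_ge0 ?(ltW xy)//= ler_pdivrMr// mul1r lerD2l lerN2.
Qed.

Lemma body_section K x : body K -> section_at K x !=set0 ->
  exists2 i, i.1 <= i.2 & section_at K x = `[i.1, i.2]%classic.
Proof.
move=> bK S0; have clK := body_closed bK; move: bK => [_ cK vK].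
apply: compact_interval => //.
  apply: (@subclosed_compact _ _ (snd @` K)).
  - apply: (preimage_closed (f := pair x)) => // y _.
    by apply: continuous_pair => ?; [exact: cvg_cst|exact: cvg_id].
  - by apply: compact_image cK; exact: continuous_snd.
  - by move=> y Ky; exists (x, y).
move=> y y' z Ky Ky' yzy'; have /andP[yz zy'] := yzy'.
have [yy'|lt] := leP y' y.
  have -> // : z = y by apply: le_anti; rewrite yz (le_trans zy').
have := vK _ _ _ Ky Ky' (ratio_in01 yzy' lt).
by rewrite /section_at /=; congr (K (_, _)); field; rewrite subr_eq0 gt_eqF.
Qed.

Lemma body_pairing p q K : body K ->
  exists2 i, i.1 <= i.2 & pairing p q @` K = `[i.1, i.2]%classic.
Proof.
move=> [[k Kk] cK vK]; apply: compact_interval.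
- by exists (pairing p q k), k.
- by apply: compact_image cK; exact: continuous_pairing.
move=> _ _ z [x Kx <-] [y Ky <-] xzy; have /andP[xz zy] := xzy.
have [yx|lt] := leP (pairing p q y) (pairing p q x).
  by exists x => //; apply: le_anti; rewrite xz (le_trans zy).
eexists; first exact: vK Kx Ky (ratio_in01 xzy lt).
set t := _ / _; rewrite /pairing /=.
rewrite (_ : _ + _ = t * pairing p q x + (1 - t) * pairing p q y).
  by rewrite /t; field; rewrite subr_eq0 gt_eqF.
by rewrite /pairing; ring.
Qed.

End Bodies.

(** * Area as an integral of lengths of sections, and its behaviour under linear maps *)

Section Area.
Context {R : realType}.
Implicit Types (A K L : set (R * R)) (S : set R) (p q : R).

Notation mu := (@lebesgue_measure R).

Lemma xsectionE A x : xsection A x = section_at A x.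
Proof. by apply/seteqP; split => y; rewrite /xsection /= inE. Qed.

Lemma product_measureE A : (mu \x mu)%E A = (\int[mu]_x mu (section_at A x))%E.
Proof. by apply: eq_integral => x _; rewrite /= xsectionE. Qed.

Lemma measurable_body K : body K ->
  measurable (K : set (measurableTypeR R * measurableTypeR R)).
Proof. by move=> /body_closed; exact: closed_measurable_prod. Qed.

Lemma measurable_section A x :
  measurable (A : set (measurableTypeR R * measurableTypeR R)) ->
  measurable (section_at A x : set (measurableTypeR R)).
Proof. by move=> mA; rewrite -xsectionE; exact: measurable_xsection. Qed.

Lemma measurable_section_measure A :
  measurable (A : set (measurableTypeR R * measurableTypeR R)) ->
  measurable_fun [set: measurableTypeR R] (fun x => mu (section_at A x)).
Proof.
move=> mA; rewrite (_ : (fun _ => _) = mu \o xsection A).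
  exact: measurable_fun_xsection.
by apply/funext => x /=; rewrite xsectionE.
Qed.

Lemma product_measure_swap A :
  measurable (A : set (measurableTypeR R * measurableTypeR R)) ->
  (mu \x mu)%E A = (mu \x mu)%E [set z | A (z.2, z.1)].
Proof.
move=> mA; have := indic_fubini_tonelli mu mu mA.
rewrite indic_fubini_tonelli_FE// indic_fubini_tonelli_GE//.
Qed.

(** A lower triangular map permutes the vertical lines, so the formula reduces to one affine
    substitution on each line and one across the lines. Together with the exchange of coordinates,
    such maps yield every determinant formula used below. *)
Lemma product_measure_triangular (a b c : R) A : a != 0 -> c != 0 ->
  measurable (A : set (measurableTypeR R * measurableTypeR R)) ->
  (mu \x mu)%E A = (`|a * c|%:E * (mu \x mu)%E (lmap a 0 b c @^-1` A))%E.
Proof.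
move=> a0 c0 mA; rewrite !product_measureE.
rewrite (ge0_integral_affine 0 a0); last 2 first.
- exact: measurable_section_measure.
- by move=> x; exact: measure_ge0.
rewrite normrM EFinM -muleA; congr (_ * _)%E.
have mf : measurable_fun [set: measurableTypeR R]
    (fun x => mu (section_at (lmap a 0 b c @^-1` A) x)).
  apply: measurable_section_measure.
  have ml : measurable_fun setT (lmap a 0 b c :
      measurableTypeR R * measurableTypeR R -> measurableTypeR R * measurableTypeR R).
    apply/measurable_fun_pairP; split; rewrite /lmap /comp /=;
    by apply: measurable_funD; apply: measurable_funM.
  by rewrite -[X in measurable X]setTI; exact: ml.
rewrite -ge0_integralZl//.
apply: eq_integral => x _; rewrite (lebesgue_measure_affine (b * x) c0).
  congr (_ * mu _)%E; apply/seteqP; split => y;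
    by rewrite /section_at /lmap /= mul0r addrC (addrC (b * x)).
exact: measurable_section.
Qed.

Lemma body_bounded K : body K ->
  exists2 M : R, 0 <= M & K `<=` `[- M, M]%classic `*` `[- M, M]%classic.
Proof.
move=> bK; have [[a b] /= ab E1] := body_pairing 1 0 bK.
have [[c d] /= cd E2] := body_pairing 0 1 bK.
exists (`|a| + `|b| + `|c| + `|d|); first by rewrite !addr_ge0.
move=> z Kz; have : [set` `[a, b]] z.1.
  by rewrite -E1; exists z => //; rewrite /pairing; ring.
have : [set` `[c, d]] z.2.
  by rewrite -E2; exists z => //; rewrite /pairing; ring.
rewrite /= !in_itv /= => /andP[z1 z2] /andP[z3 z4].
have [h1 h2 h3 h4] : [/\ - a <= `|a|, b <= `|b|, - c <= `|c| & d <= `|d|].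
  by rewrite -(normrN a) -(normrN c) !ler_norm.
have [h5 h6 h7 h8] : [/\ 0 <= `|a|, 0 <= `|b|, 0 <= `|c| & 0 <= `|d|] by [].
by split; apply/andP; split; lra.
Qed.

(** [fine] sends infinity to 0; the enclosing square makes the measure finite, hence [area]
    faithful. *)
Lemma areaE K : body K -> (area K)%:E = (mu \x mu)%E K.
Proof.
move=> bK; rewrite /area fineK// ge0_fin_numE ?measure_ge0//.
have [M M0 KM] := body_bounded bK.
apply: (@le_lt_trans _ _ ((mu \x mu)%E (`[- M, M]%classic `*` `[- M, M]%classic))).
  apply: le_measure; rewrite ?inE//; first exact: measurable_body.
  by apply: measurableX; exact: measurable_itv.
rewrite product_measure1E; try exact: measurable_itv.
rewrite (_ : (_ * _)%E = ((M - - M) * (M - - M))%:E) ?ltry//.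
by rewrite EFinM; congr (_ * _)%E; apply: lebesgue_measure_segment; lra.
Qed.

Lemma area_ge0 A : 0 <= area A.
Proof. by rewrite fine_ge0// measure_ge0. Qed.

Lemma le_area K L : body K -> body L -> K `<=` L -> area K <= area L.
Proof.
move=> bK bL KL; rewrite -lee_fin !areaE//.
by apply: le_measure; rewrite ?inE//; exact: measurable_body.
Qed.

Lemma area_triangular (a b c : R) K : a != 0 -> c != 0 -> body K ->
  area (lmap a 0 b c @` K) = `|a * c| * area K.
Proof.
move=> a0 c0 bK; apply/EFin_inj; have bT := body_lmap a 0 b c bK.
rewrite EFinM !areaE// (product_measure_triangular b a0 c0 (measurable_body bT)).
congr (_ * (mu \x mu) _)%E; apply/seteqP; split => [[x y] [[x' y'] Kz] [E1 E2]|z Kz].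
  have e1 : x' = x by apply: (mulfI a0); move: E1; rewrite /= !mul0r !addr0.
  have e2 : y' = y by apply: (mulfI c0); move: E2; rewrite /= e1 => /addrI.
  by rewrite -e1 -e2.
by exists z.
Qed.

Lemma area_swap K : body K -> area (lmap 0 1 1 0 @` K) = area K.
Proof.
move=> bK; apply/EFin_inj; have bT := body_lmap 0 1 1 0 bK.
rewrite !areaE// (product_measure_swap (measurable_body bT)).
congr ((mu \x mu) _)%E; apply/seteqP; split => [[x y] [[x' y'] Kz]|[x y] Kz].
  by rewrite /lmap /= !mul0r !mul1r addr0 add0r => -[<- <-].
by exists (x, y); rewrite // /lmap /= !mul0r !mul1r addr0 add0r.
Qed.

Lemma area_integral K : body K -> (area K)%:E = (\int[mu]_x mu (section_at K x))%E.
Proof. by move=> bK; rewrite areaE// product_measureE. Qed.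

End Area.

(** * Sums with segments, and mixed areas with zonogons *)

Section Zonogons.
Context {R : realType}.
Implicit Types (A K L : set (R * R)) (S : set R) (p q : R) (v z : R * R).

Notation mu := (@lebesgue_measure R).

(** This is the segment from [-v] to [v]: centred, so that zonogons are symmetric, and spanned by
    [2v], which explains the factors 2 below. *)
Definition segment v : set (R * R) :=
  [set z | exists2 t, -1 <= t <= 1 & z = (t * v.1, t * v.2)].

Fixpoint zonogon (s : seq (R * R)) : set (R * R) :=
  if s is v :: s' then msum (zonogon s') (segment v) else [set (0, 0)].

(* Twice the mixed area. *)
Definition mixed K L : R := area (msum K L) - area K - area L.

Lemma body_extremal p q K : body K -> exists x y, [/\ K x, K y &
  forall z, K z -> pairing p q x <= pairing p q z <= pairing p q y].
Proof.
move=> bK; have [[m M] /= mM E] := body_pairing p q bK.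
have H t : m <= t <= M -> (pairing p q @` K) t.
  by move=> tmM; rewrite E /= in_itv.
have [|x Kx xm] := H m; first by rewrite lexx mM.
have [|y Ky yM] := H M; first by rewrite mM lexx.
exists x, y; split => // z Kz; rewrite xm yM.
have : (pairing p q @` K) (pairing p q z) by exists z.
by rewrite E /= in_itv.
Qed.

Lemma sup_max S (y : R) : S y -> ubound S y -> sup S = y.
Proof.
move=> Sy uy; apply: le_anti; rewrite ge_sup ?ub_le_sup//; by exists y.
Qed.

Lemma inf_min S (y : R) : S y -> lbound S y -> inf S = y.
Proof.
move=> Sy ly; apply: le_anti; rewrite lb_le_inf ?ge_inf//; by exists y.
Qed.

Lemma widthE p q K x y : K x -> K y ->
  (forall z, K z -> pairing p q x <= pairing p q z <= pairing p q y) ->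
  width p q K = pairing p q y - pairing p q x.
Proof.
move=> Kx Ky H; congr (_ - _).
  by apply: sup_max; [exists y|move=> _ [z Kz <-]; have /andP[] := H _ Kz].
by apply: inf_min; [exists x|move=> _ [z Kz <-]; have /andP[] := H _ Kz].
Qed.

Lemma width_ge0 p q K : body K -> 0 <= width p q K.
Proof.
move=> bK; have [x [y [Kx Ky H]]] := body_extremal p q bK.
by rewrite (widthE Kx Ky H) subr_ge0; have /andP[] := H _ Kx.
Qed.

Lemma width_msum p q K L : body K -> body L ->
  width p q (msum K L) = width p q K + width p q L.
Proof.
move=> bK bL; have [x [y [Kx Ky H]]] := body_extremal p q bK.
have [x' [y' [Lx Ly H']]] := body_extremal p q bL.
rewrite (widthE Kx Ky H) (widthE Lx Ly H').
rewrite (@widthE _ _ _ (x.1 + x'.1, x.2 + x'.2) (y.1 + y'.1, y.2 + y'.2)).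
- by rewrite /pairing /=; ring.
- by exists x, x'.
- by exists y, y'.
- move=> _ [z [z' [/H /andP[h1 h2] /H' /andP[h3 h4] ->]]].
  by move: h1 h2 h3 h4; rewrite /pairing /= => *; apply/andP; split; lra.
Qed.

Lemma width_scale (c p q : R) K : body K -> width (c * p) (c * q) K = `|c| * width p q K.
Proof.
move=> bK; have [x [y [Kx Ky H]]] := body_extremal p q bK.
have E z : pairing (c * p) (c * q) z = c * pairing p q z by rewrite /pairing; ring.
rewrite (widthE Kx Ky H); have [c0|c0] := leP 0 c.
  rewrite (widthE Kx Ky) ?E ?(ger0_norm c0) ?mulrBr// => z /H /andP[h1 h2].
  by rewrite !E !ler_wpM2l.
rewrite (widthE Ky Kx) ?E ?(ltr0_norm c0); first by rewrite mulNr mulrBr opprB.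
by move=> z /H /andP[h1 h2]; rewrite !E !ler_wnM2l// ltW.
Qed.

Lemma width_lmap p q a b c d K :
  width p q (lmap a b c d @` K) = width (p * a + q * c) (p * b + q * d) K.
Proof.
rewrite /width; suff -> : pairing p q @` (lmap a b c d @` K) =
  pairing (p * a + q * c) (p * b + q * d) @` K by [].
have E z : pairing p q (lmap a b c d z) = pairing (p * a + q * c) (p * b + q * d) z.
  by rewrite /pairing /lmap /=; ring.
apply/seteqP; split => [_ [_ [z Kz <-] <-]|_ [z Kz <-]]; first by exists z.
by exists (lmap a b c d z); first by exists z.
Qed.

Lemma body_segment v : body (segment v).
Proof.
split.
- by exists (0, 0), 0; rewrite ?mul0r// oppr_le0 ler01.
- rewrite (_ : segment v = (fun t => (t * v.1, t * v.2)) @` `[-1, 1]%classic).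
    apply: compact_image (@segment_compact _ _ _).
    by apply: continuous_pair => t; apply: cvgM;
      [exact: cvg_id|exact: cvg_cst|exact: cvg_id|exact: cvg_cst].
  apply/seteqP; split => [_ [t t1 ->]|_ [t /= t1 <-]].
    by exists t; rewrite //= in_itv.
  by exists t => //; move: t1; rewrite in_itv.
- move=> _ _ t [a /andP[a1 a2] ->] [b /andP[b1 b2] ->] /andP[t0 t1].
  exists (t * a + (1 - t) * b); last by congr pair => /=; ring.
  by apply/andP; split; nra.
Qed.

Lemma lmap_segment a b c d v : lmap a b c d @` segment v = segment (lmap a b c d v).
Proof.
apply/seteqP; split => [_ [_ [t t1 ->] <-]|_ [t t1 ->]].
  by exists t => //; rewrite /lmap /=; congr pair; ring.
exists (t * v.1, t * v.2); first by exists t.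
by rewrite /lmap /=; congr pair; ring.
Qed.

(** Every non-empty vertical section gains [|s|] at both ends and empty ones stay empty; the gain is
    integrated over the projection, an interval of length [width 1 0 K]. *)
Lemma area_msum_vertical (s : R) K : body K ->
  area (msum K (segment (0, s))) = area K + 2 * `|s| * width 1 0 K.
Proof.
move=> bK; have bS := body_segment (0, s).
have [[m M] /= mM E] := body_pairing 1 0 bK.
have wE : width 1 0 K = M - m.
  rewrite /width E; congr (_ - _).
    apply: sup_max => [|x]; rewrite /= in_itv /= ?mM ?lexx//.
    by move=> /andP[].
  apply: inf_min => [|x]; rewrite /= in_itv /= ?mM ?lexx//.
  by move=> /andP[].
apply: EFin_inj; rewrite area_integral ?EFinD ?area_integral//; last exact: body_msum.
have -> : (2 * `|s| * width 1 0 K)%:E =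
    (\int[mu]_x ((2 * `|s|)%:E * (\1_`[m, M] x)%:E))%E.
  rewrite ge0_integralZl//; last exact/measurable_EFinP/measurable_indic.
  rewrite integral_indic// setIT wE EFinM; congr (_ * _)%E.
  exact/esym/lebesgue_measure_segment.
rewrite -ge0_integralD//; last 2 first.
- by apply: measurable_section_measure; exact: measurable_body.
- by apply/measurable_EFinP/measurable_funM => //; exact: measurable_indic.
apply: eq_integral => x _; rewrite indicE.
have [xP|xN] := pselect (section_at K x !=set0); last first.
  rewrite (_ : section_at K x = set0); last by apply/seteqP; split => // y Ky; case: xN; exists y.
  rewrite (_ : section_at _ x = set0).
    rewrite measure0 add0e memNset ?mule0// -E => -[[x' y] Kxy].
    by rewrite /pairing /= mul1r mul0r addr0 => e; case: xN; exists y; rewrite -e.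
  apply/seteqP; split => // y [[a b] [c [Kab [t t1 ->]]]] /= [xa _].
  by case: xN; exists b; rewrite /section_at /= xa mulr0 addr0.
rewrite mem_set; last first.
  by rewrite -E; case: xP => y Ky; exists (x, y) => //; rewrite /pairing /=; ring.
rewrite mule1; have [[i j] /= ij Eij] := body_section bK xP.
rewrite Eij lebesgue_measure_segment// -EFinD.
rewrite (_ : section_at _ x = `[i - `|s|, j + `|s|]%classic).
  rewrite lebesgue_measure_segment; first by congr EFin; ring.
  by have := normr_ge0 s; lra.
have H y : K (x, y) <-> i <= y <= j.
  by have -> : K (x, y) = section_at K x y by []; rewrite Eij /= in_itv.
apply/seteqP; split => [y [[a b] [c [Kab [t t1 ->]]]] /= [xa ->]|y].
  have : `|t * s| <= `|s|.
    by rewrite normrM ler_piMl// ler_norml.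
  rewrite ler_norml => /andP[h1 h2]; move: Kab; rewrite (_ : a = x); last by rewrite xa; ring.
  by move=> /H /andP[h3 h4]; rewrite in_itv /=; apply/andP; split; lra.
rewrite /= in_itv /= => /andP[h1 h2].
(* [u] is the point of [[i, j]] nearest to [y]. *)
have [u uij [h3 h4]] : exists2 u, i <= u <= j & - `|s| <= y - u /\ y - u <= `|s|.
  have := normr_ge0 s => s0.
  have [yi|yi] := leP y i; first by exists i; rewrite ?lexx ?ij//; split; lra.
  have [yj|yj] := leP j y; first by exists j; rewrite ?lexx ?ij//; split; lra.
  by exists y; [rewrite !ltW|split; lra].
exists (x, u), (0, y - u); split; [exact/H| |by rewrite /= addr0; congr pair; ring].
have [s0|s0] := eqVneq s 0.
  move: h3 h4; rewrite s0 normr0 => h3 h4; exists 0; first by rewrite oppr_le0 ler01.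
  by rewrite /= !mul0r; congr pair; lra.
exists ((y - u) / s); last by rewrite /= mulr0 divfK.
by rewrite -ler_norml normrM normfV ler_pdivrMr ?normr_gt0// mul1r ler_norml h3.
Qed.

(** The covector [(- v.2, v.1)] is [det(v, .)], so the width measures [K] transversally to [v]. *)
Lemma area_msum_segment v K : body K ->
  area (msum K (segment v)) = area K + 2 * width (- v.2) v.1 K.
Proof.
case: v => a b bK /=; have [->|a0] := eqVneq a 0.
  rewrite area_msum_vertical// -mulrA; congr (_ + 2 * _).
  by rewrite -normrN -width_scale// mulr1 mulr0.
(* The area-preserving map z |-> (z.2 - (b/a) z.1, z.1) makes the segment
   vertical. *)
have bS := body_segment (a, b).
have areaS L : body L -> area (lmap (- b / a) 1 1 0 @` L) = area L.
  move=> bL; rewrite -(area_swap (body_lmap _ _ _ _ bL)) image_comp.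
  rewrite (_ : _ \o _ = lmap 1 0 (- b / a) 1); last first.
    by apply/funext => z; rewrite /= lmap_comp; congr lmap; ring.
  by rewrite area_triangular ?oner_neq0// mulr1 normr1 mul1r.
rewrite -areaS; last exact: body_msum.
rewrite lmap_msum lmap_segment (_ : lmap _ _ _ _ _ = (0, a)); last first.
  by rewrite /lmap /=; congr pair; [field|ring].
rewrite area_msum_vertical; last exact: body_lmap.
rewrite areaS// width_lmap -mulrA -width_scale//; congr (_ + 2 * width _ _ _).
  by field.
by ring.
Qed.

Lemma body_zonogon s : body (zonogon s).
Proof.
elim: s => [|v s IHs] /=; last by apply: body_msum => //; exact: body_segment.
split; [by exists (0, 0)|exact: compact_set1|].
by move=> _ _ t -> -> _ /=; congr pair; ring.
Qed.

(** Adding a segment to the zonogon [Z] contributes the width of [K + Z] to the area of the sum and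
    the width of [Z] to the area of the zonogon; as widths are additive, the difference is the width
    of [K] alone. *)
Lemma mixed_zonogon s K : body K ->
  mixed K (zonogon s) = 2 * \sum_(v <- s) width (- v.2) v.1 K.
Proof.
move=> bK; rewrite /mixed; elim: s => [|v s IHs] /=.
  have -> : msum K [set (0, 0)] = K.
    apply/seteqP; split => [_ [x [_ [Kx -> ->]]]|[x y] Kz].
      by case: x Kx => a b /=; rewrite !addr0.
    by exists (x, y), (0, 0); rewrite /= !addr0.
  rewrite big_nil mulr0 subrr sub0r; apply/eqP; rewrite oppr_eq0; apply/eqP.
  rewrite /area (_ : [set (0, 0)] = [set 0] `*` [set 0]).
    by rewrite product_measure1E//= lebesgue_measure_set1 mule0.
  by apply/seteqP; split => [_ -> //|[x y] [/= -> ->]].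
have bZ := body_zonogon s.
rewrite msumA !area_msum_segment//; last exact: body_msum.
by rewrite width_msum// big_cons [in RHS]mulrDr -IHs; ring.
Qed.

(** The right-hand side is the support function of the zonogon, each segment contributing its
    own. *)
Lemma zonogon_pairing p q s z : zonogon s z ->
  pairing p q z <= \sum_(v <- s) `|pairing p q v|.
Proof.
elim: s z => [|v s IHs] z /=.
  by move=> ->; rewrite big_nil /pairing /= !mulr0 addr0.
move=> [x [_ [Zx [t t1 ->] ->]]]; rewrite big_cons.
rewrite (_ : pairing p q _ = t * pairing p q v + pairing p q x); last first.
  by rewrite /pairing /=; ring.
apply: lerD; last exact: IHs.
by rewrite (le_trans (ler_norm _))// normrM ler_piMl// ler_norml.
Qed.

Lemma zonogon_comb (I : Type) (r : seq I) (v : I -> R * R) (c : I -> R) :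
  (forall i, -1 <= c i <= 1) ->
  zonogon [seq v i | i <- r] (\sum_(i <- r) c i * (v i).1, \sum_(i <- r) c i * (v i).2).
Proof.
move=> c1; elim: r => [|i r IHr] /=; first by rewrite !big_nil.
rewrite !big_cons; do 2 eexists; split; [exact: IHr|by exists (c i)|].
by rewrite /= addrC (addrC (c i * (v i).2)).
Qed.

End Zonogons.

(** * Minkowski's inequality for a symmetric body and a zonogon *)

Section Minkowski.
Context {R : realType}.
Implicit Types (A K L : set (R * R)) (S : set R) (p q : R) (v z : R * R).

Notation mu := (@lebesgue_measure R).

Definition centered K : Prop := forall x y, K (x, y) -> K (- x, - y).

Lemma body_between K x a b y : body K -> K (x, a) -> K (x, b) -> a <= y <= b -> K (x, y).
Proof.
move=> bK Ka Kb /andP[ay yb]; have S0 : section_at K x !=set0 by exists a.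
have [[i j] /= ij E] := body_section bK S0.
have H u : section_at K x u -> i <= u <= j by rewrite E /= in_itv.
have /andP[ia _] := H a Ka; have /andP[_ bj] := H b Kb.
suff : section_at K x y by [].
by rewrite E /= in_itv /= (le_trans ia) ?(le_trans yb).
Qed.

Lemma centered_projection K : body K -> centered K ->
  exists2 r, 0 <= r & forall x, section_at K x !=set0 <-> - r <= x <= r.
Proof.
move=> bK sK; have [[m M] /= mM E] := body_pairing 1 0 bK.
have H x : section_at K x !=set0 <-> m <= x <= M.
  split=> [[y Ky]|xm].
    have : (pairing 1 0 @` K) x by exists (x, y) => //; rewrite /pairing /=; ring.
    by rewrite E /= in_itv.
  have : (pairing 1 0 @` K) x by rewrite E /= in_itv.
  by move=> [[x' y] Ky]; rewrite /pairing /= mul1r mul0r addr0 => <-; exists y.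
have opp x : section_at K x !=set0 -> section_at K (- x) !=set0.
  by move=> [y Ky]; exists (- y); exact: sK.
have [/H/opp/H h1 /H/opp/H h2] : m <= m <= M /\ m <= M <= M by rewrite !lexx mM.
have mE : m = - M by move: h1 h2 => /andP[? ?] /andP[? ?]; lra.
exists M => [|x]; first by lra.
by rewrite -mE.
Qed.

Lemma area_flat K : body K -> (forall x, section_at K x !=set0 -> x = 0) -> area K = 0.
Proof.
move=> bK H; have [M M0 KM] := body_bounded bK.
apply: le_anti; rewrite area_ge0 andbT -lee_fin areaE//.
apply: (@le_trans _ _ ((mu \x mu)%E ([set (0 : R)] `*` `[- M, M]%classic))); last first.
  by rewrite product_measure1E//= lebesgue_measure_set1 mul0e.
apply: le_measure; rewrite ?inE; first exact: measurable_body.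
  by apply: measurableX.
move=> [x y] Kz; split => /=; first by apply: H; exists y.
by have [] := KM _ Kz.
Qed.

(* The section of K + L over 2x contains the sum of the sections of K and L over x. *)
Lemma area_msum_aligned K L : body K -> body L ->
  (forall x, section_at K x !=set0 <-> section_at L x !=set0) ->
  2 * (area K + area L) <= area (msum K L).
Proof.
move=> bK bL KL; have bKL := body_msum bK bL.
have n0 : 2^-1 != 0 :> R by rewrite invr_neq0.
(* Halving the abscissa brings the section over [2x] back over [x] and halves the area. *)
suff : area K + area L <= area (lmap 2^-1 0 0 1 @` msum K L).
  by rewrite area_triangular// ?oner_neq0// mulr1 gtr0_norm ?invr_gt0//; lra.
have bS := body_lmap 2^-1 0 0 1 bKL.
rewrite -lee_fin EFinD !area_integral// -ge0_integralD//; last 2 first.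
- by apply: measurable_section_measure; exact: measurable_body.
- by apply: measurable_section_measure; exact: measurable_body.
apply: ge0_le_integral => //.
- by move=> x _; rewrite adde_ge0.
- by apply: emeasurable_funD; apply: measurable_section_measure; exact: measurable_body.
- by apply: measurable_section_measure; exact: measurable_body.
move=> x _.
have [xP|xN] := pselect (section_at K x !=set0); last first.
  have e A : ~ (section_at A x !=set0) -> section_at A x = set0.
    by move=> N; apply/seteqP; split => // y Ay; case: N; exists y.
  by rewrite (e K)// (e L) => [|/KL//]; rewrite !measure0 adde0.
have [[a b] /= ab E] := body_section bK xP.
have [[c d] /= cd F] := body_section bL (iffLR (KL x) xP).
have Ka u : a <= u <= b -> K (x, u).
  by move=> h; suff : section_at K x u by []; rewrite E /= in_itv.
have Lc u : c <= u <= d -> L (x, u).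
  by move=> h; suff : section_at L x u by []; rewrite F /= in_itv.
rewrite E F !lebesgue_measure_segment// -EFinD.
have -> : b - a + (d - c) = (b + d) - (a + c) by ring.
rewrite -lebesgue_measure_segment; last by lra.
apply: le_measure; rewrite ?inE; first exact: measurable_itv.
  by apply: measurable_section; exact: measurable_body.
have H u w : K (x, u) -> L (x, w) -> section_at (lmap 2^-1 0 0 1 @` msum K L) x (u + w).
  move=> Ku Lw; exists (x + x, u + w); first by exists (x, u), (x, w).
  by rewrite /lmap /=; congr pair; [field|ring].
move=> y; rewrite /= in_itv /= => /andP[h1 h2].
apply: (body_between (a := a + c) (b := b + d)) => //; last by rewrite h1 h2.
  by apply: H; [apply: Ka|apply: Lc]; rewrite lexx.
by apply: H; [apply: Ka|apply: Lc]; rewrite lexx andbT.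
Qed.

Lemma mixed_scale (t : R) s K : 0 <= t -> body K ->
  mixed (lmap t 0 0 t @` K) (zonogon s) = t * mixed K (zonogon s).
Proof.
move=> t0 bK; rewrite !mixed_zonogon//; last exact: body_lmap.
rewrite [RHS]mulrCA; congr (_ * _); rewrite big_distrr /=; apply: eq_bigr => v _.
rewrite -[X in _ = X * _](ger0_norm t0) width_lmap -width_scale//.
by congr width; ring.
Qed.

(** Dilating [K] by [t = b / a] gives both bodies the projection [[- b, b]]. With [k], [z] the areas
    and [m] the value of [mixed], the aligned case reads [t^2 k + z <= t m]. Squaring, and using
    that [(t^2 k + z)^2] is at least [4 t^2 k z], leaves the claim times [t^2]. *)
Lemma minkowski_zonogon s K : body K -> centered K -> centered (zonogon s) ->
  4 * (area K * area (zonogon s)) <= mixed K (zonogon s) ^+ 2.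
Proof.
move=> bK sK sZ; have bZ := @body_zonogon R s.
have [a a0 Ka] := centered_projection bK sK.
have [b b0 Zb] := centered_projection bZ sZ.
(* A body that projects to a point has area 0, and the ratio [b / a] is only needed otherwise. *)
have [aE|aN] := eqVneq a 0.
  by rewrite area_flat ?mul0r ?mulr0 ?sqr_ge0// => x /Ka; rewrite aE; lra.
have [bE|bN] := eqVneq b 0.
  by rewrite [area (zonogon s)]area_flat ?mulr0 ?sqr_ge0// => x /Zb; rewrite bE; lra.
have apos : 0 < a by rewrite lt_neqAle eq_sym aN.
have bpos : 0 < b by rewrite lt_neqAle eq_sym bN.
have t0 : 0 < b / a by rewrite divr_gt0.
have bT := body_lmap (b / a) 0 0 (b / a) bK.
have := @area_msum_aligned (lmap (b / a) 0 0 (b / a) @` K) (zonogon s) bT bZ.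
move=> /(_ _)/wrap[] => [x|].
  rewrite Zb; split => [[y [[x' y'] Kz] [<- _]]|xb].
    have /Ka/andP[h1 h2] : section_at K x' !=set0 by exists y'.
    have e : b / a * a = b by field.
    have h3 : b / a * - a <= b / a * x' by rewrite ler_pM2l.
    have h4 : b / a * x' <= b / a * a by rewrite ler_pM2l.
    by rewrite /= mul0r addr0; apply/andP; split; lra.
  have /Ka[y Ky] : - a <= x / b * a <= a.
    have /andP[h1 h2] : - 1 <= x / b <= 1.
      by rewrite ler_pdivlMr// ler_pdivrMr// mulN1r mul1r.
    have h3 : (x / b + 1) * a >= 0 by rewrite mulr_ge0//; lra.
    have h4 : (1 - x / b) * a >= 0 by rewrite mulr_ge0//; lra.
    by apply/andP; split; lra.
  exists (b / a * y), (x / b * a, y) => //.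
  by rewrite /lmap /=; congr pair; [field|ring]; rewrite ?aN ?bN.
(* Homogeneity in [K] is the point where the second body has to be a zonogon. *)
have e := mixed_scale s (ltW t0) bK.
move: e; rewrite {1}/mixed area_triangular ?gt_eqF// => e h.
set t := b / a in t0 e h; rewrite ger0_norm in e h; last by rewrite mulr_ge0 ?ltW.
have k0 := area_ge0 K; have z0 := area_ge0 (zonogon s).
set k := area K in k0 e h *; set z := area (zonogon s) in z0 e h *.
set m := mixed K _ in e *.
have h1 : t * t * k + z <= t * m by lra.
have h2 : (t * t * k + z) ^+ 2 <= (t * m) ^+ 2.
  have p0 : 0 <= t * t * k + z.
    by apply: addr_ge0 => //; apply: mulr_ge0 => //; apply: mulr_ge0; exact: ltW.
  by rewrite lerXn2r// nnegrE (le_trans p0).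
have h3 := sqr_ge0 (t * t * k - z).
have h4 : t ^+ 2 * (4 * (k * z)) <= t ^+ 2 * m ^+ 2.
  rewrite -exprMn (le_trans _ h2)//.
  rewrite [leRHS](_ : _ = t ^+ 2 * (4 * (k * z)) + (t * t * k - z) ^+ 2); last by ring.
  by rewrite lerDl.
by rewrite ler_pM2l ?exprn_gt0 in h4.
Qed.

Lemma centered_zonogon s : centered (zonogon s : set (R * R)).
Proof.
elim: s => [|v s IHs] x y /=; first by move=> [-> ->]; rewrite oppr0.
move=> [[a b] [c [/IHs Zab [t t1 ->]]]] [-> ->] /=.
exists (- a, - b), (- t * v.1, - t * v.2); split => //=.
  by exists (- t) => //; lra.
by congr pair; ring.
Qed.

End Minkowski.

(** * Zonogons inscribed in a symmetric body *)

Section Approximation.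
Context {R : realType}.
Implicit Types (A K L : set (R * R)) (p q : R) (v z : R * R).

(** By concavity the increments are at least the [k]-th one before [k] and at most that one after,
    so the absolute values open and both halves telescope. Half of this sum is what the non-vertical
    edges of the polygon contribute to its support function in the direction normal to the [k]-th
    edge. *)
Lemma sum_norm_concave (f : nat -> R) n k : (k < n)%N ->
  (forall i, (i.+1 < n)%N -> f i.+2 - f i.+1 <= f i.+1 - f i) ->
  \sum_(0 <= i < n) `|f i.+1 - f i - (f k.+1 - f k)| =
  2 * f k - f 0%N - f n + (n%:R - 2 * k%:R) * (f k.+1 - f k).
Proof.
move=> kn H; set d := f k.+1 - f k.
have anti i j : (i <= j < n)%N -> f j.+1 - f j <= f i.+1 - f i.
  move=> /andP[ij]; elim: j ij => [|j IHj] ij jn; first by move: ij; rewrite leqn0 => /eqP ->.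
  move: ij; rewrite leq_eqVlt => /orP[/eqP -> //|]; rewrite ltnS => ij.
  exact: le_trans (H _ jn) (IHj ij (ltnW jn)).
rewrite (big_cat_nat (n := k)) ?leq0n ?(ltnW kn)//=.
have -> : \sum_(0 <= i < k) `|f i.+1 - f i - d| = f k - f 0%N - k%:R * d.
  rewrite (eq_big_nat _ _ (F2 := fun i => (f i.+1 - f i) - d)); last first.
    by move=> i /andP[_ ik]; rewrite ger0_norm// subr_ge0; apply: anti; rewrite ltnW.
  by rewrite sumrB telescope_sumr// sumr_const_nat subn0 mulr_natl.
have -> : \sum_(k <= i < n) `|f i.+1 - f i - d| = (n - k)%:R * d - (f n - f k).
  rewrite (eq_big_nat _ _ (F2 := fun i => d - (f i.+1 - f i))); last first.
    by move=> i /andP[ki i_n]; rewrite distrC ger0_norm// subr_ge0; apply: anti; rewrite ki.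
  by rewrite sumrB telescope_sumr ?(ltnW kn)// sumr_const_nat mulr_natl.
by rewrite natrB ?(ltnW kn)//; ring.
Qed.

(** Unlike an integer part, [k] stays below [n] at the right end [Y = n], so it always indexes an
    edge. *)
Lemma nat_bracket n (Y : R) : (0 < n)%N -> 0 <= Y <= n%:R ->
  exists2 k, (k < n)%N & k%:R <= Y <= k.+1%:R.
Proof.
elim: n => // n IHn _ /andP[Y0 Yn].
have [n0|n0] := posnP n; first by exists 0%N => //; rewrite Y0 -n0.
have [Yn'|nY] := leP Y n%:R.
  by have [|k kn H] := IHn n0; [rewrite Y0|exists k => //; rewrite ltnW].
by exists n => //; rewrite (ltW nY).
Qed.

Section Inscribed.
Variables (B : set (R * R)) (a : R).
Hypotheses (bB : body B) (sB : centered B) (a0 : 0 < a).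
Hypothesis Ba : forall x, section_at B x !=set0 <-> - a <= x <= a.

(** The upper boundary of [B]; by symmetry the lower one is [- g (- x)]. *)
Let g x := sup (section_at B x).

Let B_top x : - a <= x <= a -> B (x, g x).
Proof.
move=> /Ba xP; have [[i j] /= ij E] := body_section bB xP.
suff : section_at B x (g x) by [].
rewrite /g E (@sup_max _ _ j) /= ?in_itv /= ?ij ?lexx//.
by move=> y /=; rewrite in_itv /= => /andP[].
Qed.

Let B_le x y : B (x, y) -> y <= g x.
Proof.
move=> Bxy; have xP : section_at B x !=set0 by exists y.
have [[i j] /= ij E] := body_section bB xP.
rewrite /g ub_le_sup// E; exists j => u /=.
by rewrite in_itv /= => /andP[].
Qed.

Let B_convex t x y x' y' : B (x, y) -> B (x', y') -> 0 <= t <= 1 ->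
  B (t * x + (1 - t) * x', t * y + (1 - t) * y').
Proof. by move: bB => [_ _ vB] Bx Bx' /(vB _ _ _ Bx Bx'). Qed.

Variable n : nat.
Hypothesis n3 : (2 < n)%N.

Let nR : n%:R != 0 :> R.
Proof. by rewrite pnatr_eq0; case: n n3. Qed.

Let n0 : 0 < n%:R :> R.
Proof. by rewrite ltr0n; case: n n3. Qed.

Variable h : R.
Hypothesis hn : h * n%:R = 2 * a.

Let node (i : nat) : R := - a + h * i%:R.
Let f i := g (node i).

Let h0 : 0 < h.
Proof. by rewrite -(pmulr_lgt0 _ n0) hn mulr_gt0. Qed.

Let nodeS i : node i.+1 = node i + h.
Proof. by rewrite /node -natr1; ring. Qed.

Let node_rev i : (i <= n)%N -> node (n - i) = - node i.
Proof. by move=> i_n; rewrite /node natrB// mulrBr hn; ring. Qed.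

Let node_in i : (i <= n)%N -> - a <= node i <= a.
Proof.
move=> i_n; have h1 : h * i%:R <= h * n%:R by rewrite ler_pM2l// ler_nat.
have h2 : 0 <= h * i%:R by rewrite mulr_ge0// ltW.
have h3 := hn.
by rewrite /node; apply/andP; split; lra.
Qed.

Let f_concave i : (i.+1 < n)%N -> f i.+2 - f i.+1 <= f i.+1 - f i.
Proof.
move=> i_n; have Bi : B (node i, f i) by exact/B_top/node_in/ltnW/ltnW.
have Bi2 : B (node i.+2, f i.+2) by exact/B_top/node_in.
have half : 0 <= (2^-1 : R) <= 1 by apply/andP; split; lra.
have := B_convex Bi Bi2 half.
rewrite (_ : 2^-1 * node i + (1 - 2^-1) * node i.+2 = node i.+1); last by rewrite !nodeS; field.
by move=> /B_le; rewrite -/(f _) => ?; lra.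
Qed.

(** The sum is the length of the section of [B] over [- a], which is the vertical edge of the
    polygon. *)
Let f_ge0 : 0 <= f 0%N + f n.
Proof.
have := sB (B_top (node_in (leqnn n))); rewrite -node_rev// subnn => /B_le.
by rewrite -/(f _) -/(f _) => ?; lra.
Qed.

(* The edge vectors, halved, of the symmetric polygon with vertices +-(node i, f i). *)
Let edge i : R * R := (h / 2, (f i.+1 - f i) / 2).
Let edges := (0, - (f 0%N + f n) / 2) :: [seq edge i | i <- index_iota 0 n].

(** If [z.1] lies between the nodes [k] and [k.+1], the line through the vertices over them, of
    slope [lam], supports the zonogon from above, and its point over [z.1] is in [B] by
    convexity. *)
Let zonogon_below z : zonogon edges z -> exists2 y, B (z.1, y) & z.2 <= y.
Proof.
move=> Zz.
have hn2 : \sum_(v <- edges) `|v.1| = a.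
  rewrite big_cons big_map /= normr0 add0r sumr_const_nat subn0 ger0_norm; last first.
    by rewrite divr_ge0// ltW.
  by rewrite -[LHS]mulr_natl mulrA (mulrC n%:R) hn; field.
have za : - a <= z.1 <= a.
  have := zonogon_pairing (-1) 0 Zz; have := zonogon_pairing 1 0 Zz.
  under eq_bigr do rewrite /pairing mul1r mul0r addr0.
  under [in X in _ -> X]eq_bigr do rewrite /pairing mulN1r mul0r addr0 normrN.
  by rewrite hn2 /pairing => ? ?; apply/andP; split; lra.
have [|k kn] := @nat_bracket n ((z.1 + a) / h) (ltnW (ltnW n3)).
  move: za => /andP[? ?]; rewrite ler_pdivrMr// (mulrC n%:R) hn.
  by apply/andP; split; [rewrite divr_ge0 ?(ltW h0)//|]; lra.
rewrite ler_pdivlMr// ler_pdivrMr// => /andP[k1 k2].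
have xk1 : node k <= z.1 by rewrite /node; lra.
have xk2 : z.1 <= node k + h by rewrite -nodeS /node; lra.
pose lam := (f k.+1 - f k) / h.
exists (f k + lam * (z.1 - node k)).
  have t01 : 0 <= (node k + h - z.1) / h <= 1.
    by rewrite ler_pdivlMr// ler_pdivrMr//; apply/andP; split; lra.
  have Bk : B (node k, f k) by exact/B_top/node_in/ltnW.
  have Bk2 : B (node k.+1, f k.+1) by exact/B_top/node_in.
  have := B_convex Bk Bk2 t01; rewrite nodeS.
  by congr (B (_, _)); rewrite /lam; field; rewrite gt_eqF.
have := zonogon_pairing (- lam) 1 Zz.
rewrite big_cons big_map.
rewrite (eq_bigr (fun i => 2^-1 * `|f i.+1 - f i - (f k.+1 - f k)|)); last first.
  move=> i _; rewrite -[X in X * `|_|]ger0_norm//.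
  by rewrite -normrM /pairing /= /lam; congr `|_|; field; rewrite gt_eqF.
rewrite -big_distrr /= (sum_norm_concave kn)//.
have -> : `|pairing (- lam) 1 (0, - (f 0%N + f n) / 2)| = (f 0%N + f n) / 2.
  by rewrite /pairing /= mulr0 add0r mul1r mulNr normrN ger0_norm// divr_ge0 ?f_ge0.
(* As [2 * a = h * n], the node is [h * (k - n / 2)]. The vertical edge cancels the end values of
   [f], and the support function becomes [f k - lam * node k], its value at the vertex. *)
rewrite /pairing mul1r (_ : (n%:R - _) * _ = - 2 * lam * node k); last first.
  rewrite /lam /node; have -> : a = h * n%:R / 2 by rewrite hn; field.
  by field; rewrite gt_eqF.
move=> ?; lra.
Qed.

(** Bounding both [z] and [-z] from above traps [z] between two points of [B] on the same vertical
    line. *)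
Let zonogon_sub : zonogon edges `<=` B.
Proof.
move=> [x y] Zz; have [u Bu yu] := zonogon_below Zz.
have [w Bw yw] := zonogon_below (centered_zonogon Zz).
have := sB Bw; rewrite /= opprK => Bw'.
by apply: (body_between bB Bw' Bu); move: yu yw => /= ? ?; apply/andP; split; lra.
Qed.

(** Half edges taken with sign [+] before [i] and [-] from [i] on telescope to the [i]-th vertex
    minus the mean of the first and last ones. This mean is vertical, and the vertical edge with
    sign [-] restores it. *)
Let zonogon_vertex i : (i <= n)%N -> zonogon edges (node i, f i).
Proof.
move=> i_n; pose c j : R := if (j < i)%N then 1 else -1.
have c1 j : -1 <= c j <= 1 by rewrite /c; case: ifP => _; apply/andP; split; lra.
rewrite /edges /=; eexists; exists (0, (f 0%N + f n) / 2); split.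
- exact: (zonogon_comb (index_iota 0 n) edge c1).
- exists (-1); first by apply/andP; split; lra.
  by rewrite /= mulr0 mulN1r mulNr opprK.
have E (u : nat -> R) : \sum_(0 <= j < n) c j * ((u j.+1 - u j) / 2) =
    u i - (u 0%N + u n) / 2.
  rewrite (big_cat_nat (n := i))//=.
  rewrite (eq_big_nat _ _ (F2 := fun j => 2^-1 * (u j.+1 - u j))); last first.
    by move=> j /andP[_ ji]; rewrite /c ji; field.
  rewrite [X in _ + X](eq_big_nat _ _ (F2 := fun j => - 2^-1 * (u j.+1 - u j))); last first.
    by move=> j /andP[ij _]; rewrite /c ltnNge ij /=; field.
  by rewrite -!big_distrr /= !telescope_sumr//; field.
congr pair; last by rewrite /= E; field.
rewrite /= (eq_bigr (fun j => c j * ((node j.+1 - node j) / 2))); last first.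
  by move=> j _; congr (_ * (_ / 2)); rewrite nodeS; ring.
by rewrite E /node; have := hn; lra.
Qed.

Let zonogon_node i y : (i <= n)%N -> B (node i, y) -> zonogon edges (node i, y).
Proof.
move=> i_n Bi; have V1 := zonogon_vertex i_n.
have := centered_zonogon (zonogon_vertex (leq_subr i n)); rewrite node_rev// opprK => V2.
apply: (body_between (body_zonogon edges) V2 V1).
rewrite (B_le Bi) andbT lerNl; apply: B_le.
by rewrite node_rev//; exact: sB.
Qed.

(** The axis is the chord of [B] through the origin ending at [(a, c * a)]. The linear map contracts
    the abscissa by [1 - t] and the height above the axis by [(1 - t)^2], hence has determinant
    [(1 - t)^3]. An image point can then slide parallel to the axis by up to [h], the node spacing,
    without leaving [B]; it reaches both neighbouring nodes, over which the zonogon contains the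
    whole section of [B]. *)
Lemma inscribed_zonogon (t : R) : t * n%:R = 2 -> exists2 s, zonogon s `<=` B &
  (1 - t) ^+ 3 * area B <= area (zonogon s).
Proof.
move=> tn; exists edges; first exact: zonogon_sub.
have n3R : 3 <= n%:R :> R by rewrite ler_nat.
have t0 : 0 < t by rewrite -(pmulr_lgt0 _ n0) tn.
have t1 : t < 1 by rewrite -(ltr_pM2r n0) tn; lra.
have th : t * a = h by apply: (mulIf nR); rewrite hn mulrAC tn.
have [c Bc] : exists c, B (a, c * a).
  have [y By] : section_at B a !=set0.
    by apply/Ba; rewrite lexx andbT (le_trans _ (ltW a0))// oppr_le0 ltW.
  by exists (y / a); rewrite divfK// gt_eqF.
have Bline e : - a <= e <= a -> B (e, c * e).
  move=> /andP[e1 e2]; have t01 : 0 <= (e + a) / (2 * a) <= 1.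
    by rewrite divr_ge0 ?ler_pdivrMr ?mulr_gt0//; lra.
  by have := B_convex Bc (sB Bc) t01; congr (B (_, _)); field; rewrite gt_eqF.
(* With [h = t * a], this value solves [(1 - lam) * a = h + (1 - t) * t * a], the equation [la] that
   bounds the slide. *)
pose lam := (1 - t) ^+ 2.
have lam1 : 0 < 1 - lam by rewrite /lam; nra.
have lam0 : 0 <= lam by exact: sqr_ge0.
pose kap := c * (1 - t) - c * lam.
suff sub : lmap (1 - t) 0 kap lam @` B `<=` zonogon edges.
  apply: le_trans (le_area (body_lmap _ _ _ _ bB) (body_zonogon _) sub).
  rewrite area_triangular//; last 2 first.
  - by rewrite subr_eq0 gt_eqF.
  - by rewrite /lam expf_neq0// subr_eq0 gt_eqF.
  by rewrite ger0_norm /lam -?exprS// mulr_ge0 ?sqr_ge0//; lra.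
move=> _ [[x y] Bxy <-]; pose X := (1 - t) * x.
have /andP[xa1 xa2] : - a <= x <= a by apply/Ba; exists y.
(* The slid point is [lam] times [(x, y)] plus [1 - lam] times the axis point over [e]; it remains
   to see that [e] is in [[- a, a]]. *)
have Q u : - h <= u - X <= h -> B (u, c * u + lam * (y - c * x)).
  move=> /andP[u1 u2]; pose e := (u - lam * x) / (1 - lam).
  have xx : - ((1 - t) * t * a) <= X - lam * x <= (1 - t) * t * a.
    rewrite (_ : X - _ = (1 - t) * t * x); last by rewrite /X /lam; ring.
    have : 0 <= (1 - t) * t by rewrite mulr_ge0//; lra.
    by move=> ?; apply/andP; split; nra.
  have la : (1 - lam) * a = h + (1 - t) * t * a by rewrite -th /lam; ring.
  have ea : - a <= e <= a.
    move: xx => /andP[xx1 xx2].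
    by rewrite /e ler_pdivlMr// ler_pdivrMr//; apply/andP; split; lra.
  have l01 : 0 <= lam <= 1 by apply/andP; split; lra.
  have := B_convex Bxy (Bline _ ea) l01.
  by congr (B (_, _)); rewrite /e; field; rewrite gt_eqF.
have Xa : - a <= X <= a by rewrite /X; apply/andP; split; nra.
have [|k kn] := @nat_bracket n ((X + a) / h) (ltnW (ltnW n3)).
  move: Xa => /andP[? ?]; rewrite ler_pdivrMr// (mulrC n%:R) hn.
  by apply/andP; split; [rewrite divr_ge0 ?(ltW h0)//|]; lra.
rewrite ler_pdivlMr// ler_pdivrMr// => /andP[k1 k2].
have xk1 : node k <= X by rewrite /node; lra.
have xk2 : X <= node k + h by rewrite -nodeS /node; lra.
have Zk : zonogon edges (node k, c * node k + lam * (y - c * x)).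
  by apply: zonogon_node (ltnW kn) _; apply: Q; have := h0; lra.
have Zk2 : zonogon edges (node k.+1, c * node k.+1 + lam * (y - c * x)).
  by apply: zonogon_node kn _; apply: Q; rewrite nodeS; have := h0; lra.
(* The image point divides the segment between its two slid copies in this ratio. *)
have t01 : 0 <= (node k + h - X) / h <= 1.
  by rewrite ler_pdivlMr// ler_pdivrMr//; apply/andP; split; lra.
have [_ _ vZ] := body_zonogon edges.
have := vZ _ _ _ Zk Zk2 t01; rewrite /lmap /= nodeS.
by congr (zonogon edges (_, _)); rewrite /kap /X; field; rewrite gt_eqF.
Qed.

End Inscribed.
End Approximation.

(** * From zonogons to arbitrary symmetric bodies *)

Section MixedAreaInequality.
Context {R : realType}.
Implicit Types (B K L : set (R * R)).

Definition difference_body K : set (R * R) := msum K (lmap (-1) 0 0 (-1) @` K).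

Lemma body_difference K : body K -> body (difference_body K).
Proof. by move=> bK; apply: body_msum => //; exact: body_lmap. Qed.

Lemma centered_difference K : centered (difference_body K).
Proof.
move=> x y [[a b] [_ [Kab [[c d] Kcd <-]]]] [-> ->].
exists (c, d), (lmap (-1) 0 0 (-1) (a, b)); split; [by []|by exists (a, b)|].
by rewrite /lmap /=; congr pair; ring.
Qed.

Lemma width_difference p q K : body K -> width p q (difference_body K) = 2 * width p q K.
Proof.
move=> bK; rewrite width_msum//; last exact: body_lmap.
rewrite width_lmap (_ : p * -1 + q * 0 = -1 * p); last by ring.
rewrite (_ : p * 0 + q * -1 = -1 * q); last by ring.
by rewrite width_scale// normrN1; ring.
Qed.

Lemma mixed_difference_zonogon K s : body K ->
  area (difference_body K) * area (zonogon s) <= mixed K (zonogon s) ^+ 2.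
Proof.
move=> bK; have bD := body_difference bK.
have := minkowski_zonogon bD (@centered_difference K) (@centered_zonogon R s).
rewrite (_ : mixed _ _ = 2 * mixed K (zonogon s)); first by rewrite exprMn; lra.
rewrite !mixed_zonogon//; congr (_ * _); rewrite big_distrr /=; apply: eq_bigr => v _.
exact: width_difference.
Qed.

Lemma mixed_zonogon_ge0 K s : body K -> 0 <= mixed K (zonogon s).
Proof.
move=> bK; rewrite mixed_zonogon// mulr_ge0//.
by apply: sumr_ge0 => v _; exact: width_ge0.
Qed.

(** A failure would have a fixed positive defect [b * d - m ^+ 2], whereas the inequality for an
    inscribed zonogon with [t = 2 / n] bounds this defect by [t * C], which is smaller for large
    [n]. *)
Lemma mixed_difference_body K B : body K -> body B -> centered B ->
  area B * area (difference_body K) <= mixed K B ^+ 2.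
Proof.
move=> bK bB sB; have [r r0 Br] := centered_projection bB sB.
have [rE|rN] := eqVneq r 0.
  by rewrite area_flat ?mul0r ?sqr_ge0// => x /Br; rewrite rE; lra.
have rpos : 0 < r by rewrite lt_neqAle eq_sym rN.
rewrite leNgt; apply/negP => lt.
pose b := area B; pose d := area (difference_body K); pose m := mixed K B.
(* The three terms come from [d * (1 - 3 * t) * b <= (m + 3 * t * b) ^+ 2], where [1 - 3 * t] bounds
   [(1 - t) ^+ 3] from below and [t < 1] absorbs the quadratic term. *)
pose C := 3 * d * b + 6 * `|m| * b + 9 * b ^+ 2.
have [n n3 nC] : exists2 n : nat, (2 < n)%N & 2 * C < n%:R * (b * d - m ^+ 2).
  exists (maxn 3 (Num.truncn (2 * C / (b * d - m ^+ 2))).+1); first by rewrite leq_max leqnn.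
  rewrite -ltr_pdivrMr; last by rewrite subr_gt0.
  apply: lt_le_trans (truncnS_gt _) _.
  by rewrite ler_nat leq_max leqnn orbT.
have n0 : 0 < n%:R :> R by rewrite ltr0n; case: n n3 {nC}.
have n3R : 3 <= n%:R :> R by rewrite ler_nat.
have [t tn] : exists t : R, t * n%:R = 2 by exists (2 / n%:R); rewrite divfK ?gt_eqF.
have [h hn] : exists h : R, h * n%:R = 2 * r by exists (2 * r / n%:R); rewrite divfK ?gt_eqF.
have t0 : 0 < t by rewrite -(pmulr_lgt0 _ n0) tn.
have t1 : t < 1 by rewrite -(ltr_pM2r n0) tn; lra.
have [s sub big] := inscribed_zonogon bB sB rpos Br n3 hn tn.
have h1 := mixed_difference_zonogon s bK.
have h2 := @mixed_zonogon_ge0 K s bK.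
have h3 : mixed K (zonogon s) <= m + b - area (zonogon s).
  rewrite /m /mixed -/b subrK !lerD2r.
  apply: le_area; last exact: subset_msum.
    exact: body_msum bK (body_zonogon s).
  exact: body_msum bK bB.
have b0 : 0 <= b := area_ge0 _; have d0 : 0 <= d := area_ge0 _.
have cube : 1 - 3 * t <= (1 - t) ^+ 3.
  have -> : (1 - t) ^+ 3 = 1 - 3 * t + t ^+ 2 * (3 - t) by ring.
  by rewrite lerDl mulr_ge0 ?sqr_ge0//; lra.
have h4 : (1 - 3 * t) * b <= area (zonogon s) by apply: le_trans big; exact: ler_wpM2r.
have h5 : mixed K (zonogon s) <= m + 3 * t * b by lra.
have h6 : mixed K (zonogon s) ^+ 2 <= (m + 3 * t * b) ^+ 2.
  by rewrite lerXn2r// nnegrE (le_trans h2).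
have h7 : d * ((1 - 3 * t) * b) <= (m + 3 * t * b) ^+ 2.
  by apply: le_trans h6; apply: le_trans h1; rewrite ler_wpM2l.
have h8 : b * d - m ^+ 2 <= t * C.
  have -> : t * C = 3 * t * d * b + 6 * t * (`|m| * b) + 9 * t * b ^+ 2 by rewrite /C; ring.
  have e1 : 6 * t * (m * b) <= 6 * t * (`|m| * b).
    by rewrite ler_wpM2l ?mulr_ge0 ?(ltW t0)// ler_wpM2r// ler_norm.
  have e2 : 9 * t ^+ 2 * b ^+ 2 <= 9 * t * b ^+ 2.
    rewrite ler_wpM2r ?sqr_ge0// ler_wpM2l// expr2 ler_piMl ?ltW//.
  have e3 : (m + 3 * t * b) ^+ 2 = m ^+ 2 + 6 * t * (m * b) + 9 * t ^+ 2 * b ^+ 2 by ring.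
  have e4 : d * ((1 - 3 * t) * b) = b * d - 3 * t * d * b by ring.
  by rewrite e3 e4 in h7; lra.
have h9 : n%:R * (b * d - m ^+ 2) <= n%:R * (t * C) by rewrite ler_pM2l.
have e : n%:R * (t * C) = 2 * C by rewrite mulrA (mulrC n%:R) tn.
by lra.
Qed.

End MixedAreaInequality.

(** * Coordinate measures in dimensions 1 and 2, and the volumes of the Euclidean balls *)

Section Coordinates.
Context {R : realType}.

Notation mu := (@lebesgue_measure R).

Definition row1 (x : R) : 'rV[R]_1 := \row_i x.
Definition row2 (z : R * R) : 'rV[R]_2 := \row_i (if i == ord0 then z.1 else z.2).

Lemma row_mx_row1 (x : R) (y : 'rV[R]_0) : row_mx (x%:M : 'rV_1) y = row1 x.
Proof.
apply/rowP => i; rewrite !mxE; case: splitP => [j _|[]//].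
by rewrite !ord1 mxE eqxx.
Qed.

Lemma row_mx_row2 (x y : R) : row_mx (x%:M : 'rV_1) (row1 y) = row2 (x, y).
Proof.
apply/rowP => i; rewrite !mxE; case: splitP => j ij; rewrite !ord1 ?mxE /=.
  by rewrite mulr1n ifT//; apply/eqP/val_inj; rewrite /= ij ord1.
by rewrite ifF//; apply/eqP => i0; move: ij; rewrite i0 /= ord1.
Qed.

Lemma lebesgue_rV1E (A : set 'rV[R]_1) : measurable (row1 @^-1` A : set (measurableTypeR R)) ->
  lebesgue_rV A = mu (row1 @^-1` A).
Proof.
move=> mA; rewrite /= -[row1 @^-1` A]setIT -integral_indic//=; apply: eq_integral => x _.
by rewrite !indicE; congr ((nat_of_bool _)%:R%:E); apply/idP/idP; rewrite !inE /= row_mx_row1.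
Qed.

Lemma lebesgue_rV2E (A : set 'rV[R]_2) : measurable
    (row2 @^-1` A : set (measurableTypeR R * measurableTypeR R)) ->
  lebesgue_rV A = (mu \x mu)%E (row2 @^-1` A).
Proof.
move=> mA; rewrite product_measureE; apply: eq_integral => x _.
have E : row1 @^-1` [set y | A (row_mx (x%:M : 'rV_1) y)] =
    section_at (row2 @^-1` A) x.
  by apply/seteqP; split => y; rewrite /section_at /= row_mx_row2.
by rewrite -E -lebesgue_rV1E// E; exact: measurable_section.
Qed.

Lemma sqr_le_norm (x s : R) : 0 <= s -> (x ^+ 2 <= s ^+ 2) = (`|x| <= s).
Proof. by move=> s0; rewrite -[x ^+ 2]real_normK ?num_real// ler_pXn2r// nnegrE. Qed.

Lemma omega1 : omega R 1 = 2.
Proof.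
rewrite /omega; have E : row1 @^-1` [set x : 'rV[R]_1 | \sum_(i < 1) x 0 i ^+ 2 <= 1] =
    `[-1, 1]%classic.
  by apply/seteqP; split => x /=; rewrite big_ord1 mxE in_itv /= -ler_norml
    -sqr_le_norm// expr1n.
rewrite lebesgue_rV1E E; last exact: measurable_itv.
by rewrite lebesgue_measure_segment /=; lra.
Qed.

Lemma integral_cos_sqr :
  (\int[mu]_(x in `[(- (pi / 2))%R, (pi / 2)%R]) (2 * cos x * cos x)%:E = (pi)%:E)%E.
Proof.
have pi0 := @pi_gt0 R.
have ptN : - (pi / 2) < pi / 2 :> R by lra.
(* The derivative [1 + cos^2 - sin^2] equals [2 cos^2]. *)
rewrite (@continuous_FTC2 _ _ (fun x => x + sin x * cos x))//.
- rewrite sinN cosN cos_pihalf !mulr0 !addr0 -EFinD; congr EFin; lra.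
- apply: continuous_subspaceT => x.
  by apply: cvgM; [apply: cvgM; [exact: cvg_cst|exact: continuous_cos]|exact: continuous_cos].
- split => [x _||].
  + by apply: derivableD => //; apply: derivableM.
  + apply: cvg_at_right_filter; apply: cvgD; first exact: cvg_id.
    by apply: cvgM; [exact: continuous_sin|exact: continuous_cos].
  + apply: cvg_at_left_filter; apply: cvgD; first exact: cvg_id.
    by apply: cvgM; [exact: continuous_sin|exact: continuous_cos].
- move=> x _; rewrite derive1E.
  have : is_derive x 1 (fun x => x + sin x * cos x : R^o) (1 + (sin x *: - sin x + cos x *: cos x)).
    by apply: is_deriveD; apply: is_deriveM.
  move=> /(@derive_val _ _ _ _ _ _ _) ->.
  have := cos2Dsin2 x; rewrite /GRing.scale /= => h.
  by lra.
Qed.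

Lemma integral_disc :
  (\int[mu]_(x in `[(-1)%R, 1%R]) (2 * Num.sqrt (1 - x ^+ 2))%:E = (pi)%:E)%E.
Proof.
have pi0 := @pi_gt0 R.
have dsin : derive1 (@sin R) = cos by apply/funext => x; rewrite derive1E derive_val.
(* Bounds written as values of [sin] prepare the substitution by [sin]. *)
transitivity (\int[mu]_(x in `[sin (- (pi / 2)), sin (pi / 2)])
    (2 * Num.sqrt (1 - x ^+ 2))%:E)%E; first by rewrite sinN sin_pihalf.
rewrite integration_by_substitution_increasing.
- rewrite -integral_cos_sqr; apply: eq_integral => x; rewrite inE /= in_itv /= => xI.
  rewrite !fctE /= derive1E derive_val; congr ((2 * _ * _)%:E).
  have -> : 1 - sin x ^+ 2 = cos x ^+ 2 by rewrite -(cos2Dsin2 x); ring.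
  by rewrite sqrtr_sqr ger0_norm// cos_ge0_pihalf.
- by lra.
- by move=> x y xI yI; rewrite ltr_sin.
- by move=> x _; rewrite dsin; exact: continuous_cos.
- by rewrite dsin; apply/cvg_ex; exists (cos (- (pi / 2)));
  apply: cvg_at_right_filter; exact: continuous_cos.
- by rewrite dsin; apply/cvg_ex; exists (cos (pi / 2));
  apply: cvg_at_left_filter; exact: continuous_cos.
- split => [x _||].
  + exact: derivable_sin.
  + by apply: cvg_at_right_filter; exact: continuous_sin.
  + by apply: cvg_at_left_filter; exact: continuous_sin.
- apply: continuous_subspaceT => x; apply: cvgM; first exact: cvg_cst.
  apply: continuous_comp; last exact: sqrt_continuous.
  by apply: cvgB; [exact: cvg_cst|exact: exprn_continuous].
Qed.

Lemma omega2 : omega R 2 = pi.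
Proof.
rewrite /omega; set A := [set _ | _].
have E : row2 @^-1` A = [set z : R * R | z.1 ^+ 2 + z.2 ^+ 2 <= 1].
  by apply/seteqP; split => z; rewrite /A /= big_ord_recl big_ord1 !mxE.
have mE : measurable ([set z | z.1 ^+ 2 + z.2 ^+ 2 <= 1] :
    set (measurableTypeR R * measurableTypeR R)).
  apply: closed_measurable_prod.
  apply: (preimage_closed (f := fun z : R * R => z.1 ^+ 2 + z.2 ^+ 2) _ (@closed_le _ 1)).
  move=> z _.
  apply: cvgD; apply: (continuous_comp _ (@exprn_continuous _ 2 _)).
    exact: continuous_fst.
  exact: continuous_snd.
rewrite lebesgue_rV2E E// product_measureE.
rewrite -[RHS]/(fine (pi)%:E) -integral_disc [in RHS]integral_mkcond; congr fine.
apply: eq_integral => x _; rewrite patchE.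
case: ifPn => [|/negP xN].
  rewrite inE /= in_itv /= -ler_norml => x1; set s := Num.sqrt _.
  have s2 : s ^+ 2 = 1 - x ^+ 2.
    by rewrite sqr_sqrtr// subr_ge0 -[leRHS](expr1n R 2) sqr_le_norm.
  rewrite (_ : section_at _ x = `[- s, s]%classic); last first.
    apply/seteqP; split => y; rewrite /section_at /= in_itv /= -ler_norml.
      by move=> h; rewrite -sqr_le_norm ?sqrtr_ge0// s2; lra.
    by rewrite -sqr_le_norm ?sqrtr_ge0// s2; lra.
  rewrite lebesgue_measure_segment; first by congr EFin; ring.
  by have := sqrtr_ge0 (1 - x ^+ 2); rewrite -/s; lra.
rewrite (_ : section_at _ x = set0) ?measure0//.
apply/seteqP; split => // y; rewrite /section_at /= => h; apply: xN.
rewrite inE /= in_itv /= -ler_norml -sqr_le_norm// expr1n.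
by have := sqr_ge0 y; lra.
Qed.

End Coordinates.

(** * Separation, support functions and dilations *)

Section PlaneConvexity.
Context {R : realType}.
Implicit Types (B K L : set (R * R)).

(** The normal is [z - w0], with [w0] the point of [K] nearest to [z]: from [w0], a small move
    towards a point of [K] beyond the line through [w0] with this normal would come closer to
    [z]. *)
Lemma separation K z : body K -> ~ K z ->
  exists p q, (p, q) != (0, 0) /\ forall w, K w -> pairing p q w < pairing p q z.
Proof.
move=> [K0 cK vK] Kz.
pose dist w := (z.1 - w.1) ^+ 2 + (z.2 - w.2) ^+ 2.
have cd : {within K, continuous dist}.
  apply: continuous_subspaceT => w.
  have csq (u : R) (f : R * R -> R) : continuous f ->
      (u - f w') ^+ 2 @[w' --> w] --> (u - f w) ^+ 2.
    move=> cf; apply: (@continuous_comp _ _ _ (fun w' => u - f w') (fun x => x ^+ 2)).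
      by apply: cvgB; [exact: cvg_cst|exact: cf].
    exact: exprn_continuous.
  by apply: cvgD; [apply: csq; exact: continuous_fst|apply: csq; exact: continuous_snd].
have [w0 /set_mem Kw0 minw0] := compact_EVT_min K0 cK cd.
pose p := z.1 - w0.1; pose q := z.2 - w0.2.
have pq0 : (p, q) != (0, 0).
  apply/eqP => -[/eqP + /eqP]; rewrite !subr_eq0 => /eqP e1 /eqP e2.
  by apply: Kz; case: (z) (w0) Kw0 e1 e2 => ? ? [? ?] /= + -> ->.
have npos : 0 < p ^+ 2 + q ^+ 2.
  rewrite lt_neqAle addr_ge0 ?sqr_ge0// andbT eq_sym paddr_eq0 ?sqr_ge0// !sqrf_eq0.
  by rewrite -xpair_eqE.
exists p, q; split => // w Kw.
suff : pairing p q w <= pairing p q w0.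
  move=> /le_lt_trans; apply; rewrite -subr_gt0.
  by rewrite (_ : _ - _ = p ^+ 2 + q ^+ 2)// /pairing /p /q; ring.
rewrite leNgt; apply/negP => lt.
pose s := pairing p q w - pairing p q w0.
have s0 : 0 < s by rewrite subr_gt0.
pose m := (w.1 - w0.1) ^+ 2 + (w.2 - w0.2) ^+ 2.
have m0 : 0 <= m by rewrite addr_ge0 ?sqr_ge0.
have sm : 0 < s + m by rewrite ltr_wpDr.
(* A move by [t] lowers the squared distance by [t * (2 * s - t * m)]; this [t] is at most 1 and has
   [t * m <= s], even if [m] is large. *)
pose t := s / (s + m).
have t01 : 0 <= t <= 1.
  by rewrite divr_ge0 ?(ltW s0) ?(ltW sm)//= ler_pdivrMr// mul1r lerDl.
have t0 : 0 < t by rewrite divr_gt0.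
have := minw0 _ (mem_set (vK _ _ _ Kw Kw0 t01)).
have -> : dist (t * w.1 + (1 - t) * w0.1, t * w.2 + (1 - t) * w0.2) =
    dist w0 - t * (2 * s - t * m).
  by rewrite /dist /s /m /pairing /p /q /=; ring.
rewrite lerBrDr gerDl leNgt mulr_gt0//.
have tm : t * m <= s.
  by rewrite /t mulrAC ler_pdivrMr// ler_pM2l// lerDr ltW.
by rewrite subr_gt0; lra.
Qed.

(** Used both ways, this shows that the support function determines the body, hence that the
    projection body is unique. Covectors are non-zero because the projection body is prescribed only
    there. *)
Lemma sub_body K L : body K -> body L ->
  (forall p q, (p, q) != (0, 0) -> sup (pairing p q @` K) <= sup (pairing p q @` L)) ->
  K `<=` L.
Proof.
move=> bK bL H z Kz; apply: contrapT => Lz.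
have [p [q [pq0 sep]]] := separation bL Lz.
have := H _ _ pq0; apply/negP; rewrite -ltNge.
have [x [y [Lx Ly xy]]] := body_extremal p q bL.
rewrite (@sup_max _ _ (pairing p q y)); last 2 first.
- by exists y.
- by move=> _ [w Lw <-]; have /andP[] := xy _ Lw.
apply: lt_le_trans (sep _ Ly) _.
apply: ub_le_sup; last by exists z.
have [x' [y' [_ _ xy']]] := body_extremal p q bK.
by exists (pairing p q y') => _ [w Kw <-]; have /andP[] := xy' _ Kw.
Qed.

(** The widths that prescribe the projection body of [K] are thereby values of one support
    function. *)
Lemma sup_difference_body p q K : body K ->
  sup (pairing p q @` difference_body K) = width p q K.
Proof.
move=> bK; have [x [y [Kx Ky xy]]] := body_extremal p q bK.
have E u w : pairing p q (u.1 + (lmap (-1) 0 0 (-1) w).1, u.2 + (lmap (-1) 0 0 (-1) w).2) =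
    pairing p q u - pairing p q w by rewrite /pairing /lmap /=; ring.
rewrite (widthE Kx Ky xy) -E; apply: sup_max.
  by eexists; [exists y, (lmap (-1) 0 0 (-1) x); split; [by []|by exists x|]|].
move=> _ [_ [u [_ [Ku [w Kw <-] ->]]] <-]; rewrite !E.
by have /andP[? ?] := xy _ Ku; have /andP[? ?] := xy _ Kw; lra.
Qed.

Lemma dilation_msum B (s t : R) : body B -> 0 < s -> 0 < t ->
  msum (lmap s 0 0 s @` B) (lmap t 0 0 t @` B) = lmap (s + t) 0 0 (s + t) @` B.
Proof.
move=> [_ _ vB] s0 t0; have st : s + t != 0 by rewrite gt_eqF// addr_gt0.
apply/seteqP; split => [_ [_ [_ [[x Bx <-] [y By <-] ->]]]|_ [x Bx <-]].
  have st01 : 0 <= s / (s + t) <= 1.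
    have stp : 0 < s + t by exact: addr_gt0.
    by rewrite divr_ge0 ?(ltW s0) ?(ltW stp)//= ler_pdivrMr// mul1r lerDl ltW.
  eexists; first exact: vB Bx By st01.
  by rewrite /lmap /=; congr pair; field.
exists (lmap s 0 0 s x), (lmap t 0 0 t x); split; [by exists x|by exists x|].
by rewrite /lmap /=; congr pair; ring.
Qed.

Lemma area_dilation B (s : R) : body B -> 0 < s ->
  area (lmap s 0 0 s @` B) = s ^+ 2 * area B.
Proof. by move=> bB s0; rewrite area_triangular ?gt_eqF// gtr0_norm ?mulr_gt0. Qed.

Lemma difference_body_dilation B (s : R) : body B -> centered B -> 0 < s ->
  difference_body (lmap s 0 0 s @` B) = lmap (2 * s) 0 0 (2 * s) @` B.
Proof.
move=> bB sB s0; rewrite (_ : 2 * s = s + s); last by ring.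
rewrite -dilation_msum// /difference_body; congr msum.
rewrite image_comp; apply/seteqP; split => _ [[x y] Bxy <-];
  by exists (- x, - y); [exact: sB|rewrite /lmap /=; congr pair; ring].
Qed.

Lemma mixed_dilation B (s : R) : body B -> 0 < s ->
  mixed (lmap s 0 0 s @` B) B = 2 * s * area B.
Proof.
move=> bB s0; have E : B = lmap 1 0 0 1 @` B.
  by apply/seteqP; split => [z Bz|_ [z Bz <-]]; rewrite ?lmap1//; exists z; rewrite ?lmap1.
rewrite /mixed {2}E dilation_msum// !area_dilation//; last by rewrite addr_gt0.
by ring.
Qed.

Lemma area_linear_antidiagonal (d : R) K : d != 0 -> body K ->
  area (lmap 0 d (- d) 0 @` K) = d ^+ 2 * area K.
Proof.
move=> d0 bK; rewrite (_ : lmap 0 d (- d) 0 @` K = lmap d 0 0 (- d) @` (lmap 0 1 1 0 @` K)).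
  rewrite area_triangular ?oppr_eq0//; last exact: body_lmap.
  by rewrite area_swap// mulrN normrN -expr2 ger0_norm ?sqr_ge0.
rewrite image_comp; congr image; apply/funext => z /=.
by rewrite lmap_comp; congr lmap; ring.
Qed.

End PlaneConvexity.

(** * Transfer between an abstract plane and pairs of reals *)

Section VectorCoordinates.
Context {R : realType}.
Implicit Types (U V : vectType R).

Lemma of_coords_bij n U : \dim {:U} = n -> bijective (@of_coords R n U).
Proof.
move=> e; case: n / e.
exists (fun u => \row_i coord (vbasis {:U}) i u) => [x|u].
  apply/rowP => i; rewrite mxE /of_coords coord_sum_free//.
  exact/basis_free/vbasisP.
rewrite [RHS](coord_vbasis (memvf u)) /of_coords.
by apply: eq_bigr => i _; rewrite mxE.
Qed.

Definition plane U (z : R * R) : U := of_coords U (row2 z).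

Lemma planeE U z : plane U z = z.1 *: basis_vec U 0 + z.2 *: basis_vec U 1.
Proof. by rewrite /plane /of_coords big_ord_recl big_ord1 !mxE. Qed.

Lemma row2_coords (x : 'rV[R]_2) : row2 (x 0 ord0, x 0 ord_max) = x.
Proof.
apply/rowP => i; rewrite mxE /=; case: eqP => [->//|/eqP i0].
by congr (x 0 _); apply/val_inj; case: i i0 => [[|[|]]].
Qed.

Lemma row2_bij : bijective (@row2 R).
Proof.
exists (fun x : 'rV[R]_2 => (x 0 ord0, x 0 ord_max)) => [[x y]|x]; first by rewrite !mxE.
exact: row2_coords.
Qed.

Lemma plane_bij U : \dim {:U} = 2%N -> bijective (plane U).
Proof. by move=> e; apply: bij_comp row2_bij; exact: of_coords_bij. Qed.

Lemma row2_continuous : continuous (@row2 R).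
Proof.
rewrite (_ : @row2 R = (fun z => z.1 *: row2 (1, 0) + z.2 *: row2 (0, 1))).
  by move=> z; apply: cvgD; apply: cvgZr_tmp; [exact: cvg_fst|exact: cvg_snd].
apply/funext => z; apply/rowP => i; rewrite !mxE /=.
by case: ifP => _; rewrite ?mulr0 ?mulr1 ?addr0 ?add0r.
Qed.

Lemma compact_inE U (L : set U) : \dim {:U} = 2%N ->
  compact_in L <-> compact (plane U @^-1` L).
Proof.
(* The dimension occurs in the type of the coordinate rows; stating this for a variable [n] lets the
   equality be eliminated. *)
have E n : \dim {:U} = n -> compact_in L = compact (@of_coords R n U @^-1` L).
  by move=> e; case: n / e.
move=> /E ->.
split=> cL.
  rewrite (_ : plane U @^-1` L = (fun x : 'rV_2 => (x 0 ord0, x 0 ord_max)) @`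
      (@of_coords R 2 U @^-1` L)).
    apply: compact_image cL.
    by apply: continuous_pair => x; exact: coord_continuous.
  apply/seteqP; split => [z Lz|_ [x Lx <-]].
    by exists (row2 z); rewrite // !mxE; case: (z).
  by rewrite /= /plane row2_coords.
rewrite (_ : _ @^-1` L = @row2 R @` (plane U @^-1` L)).
  by apply: compact_image cL; exact: row2_continuous.
apply/seteqP; split => [x Lx|_ [z Lz <-]//].
by exists (x 0 ord0, x 0 ord_max); rewrite /= /plane row2_coords.
Qed.

Lemma convex_setE U (L : set U) : convex_set (L : set (convex_lmodType U)) <->
  forall x y (t : R), L x -> L y -> 0 <= t <= 1 -> L (t *: x + (1 - t) *: y).
Proof.
split=> [H x y t Lx Ly /andP[t0 t1]|H x y t /set_mem Lx /set_mem Ly].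
  have := H x y (Itv01 t0 t1) (mem_set Lx) (mem_set Ly).
  by move/set_mem.
apply/mem_set; apply: (H x y t%:num) => //; apply/andP; split; [exact: ge0|exact: le1].
Qed.

Lemma plane_comb U (t : R) x y :
  plane U (t * x.1 + (1 - t) * y.1, t * x.2 + (1 - t) * y.2) =
  t *: plane U x + (1 - t) *: plane U y.
Proof.
by rewrite !planeE /= !scalerDr !scalerA !scalerDl addrACA.
Qed.

Lemma convex_bodyE U (L : set U) : \dim {:U} = 2%N ->
  convex_body L <-> body (plane U @^-1` L).
Proof.
move=> e; have [co K1 K2] := plane_bij e; split=> -[L0 cL vL]; split.
- by case: L0 => x Lx; exists (co x); rewrite /= K2.
- exact/compact_inE.
- move=> x y t Lx Ly t01; rewrite /= plane_comb.
  by move/convex_setE: vL; apply.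
- by case: L0 => x Lx; exists (plane U x).
- exact/compact_inE.
- apply/convex_setE => x y t Lx Ly t01.
  rewrite -(K2 x) -(K2 y) -plane_comb; apply: vL => //=; by rewrite K2.
Qed.

Lemma linear_lmap (f : R * R -> R * R) :
  (forall (a : R) x y, f (a * x.1 + y.1, a * x.2 + y.2) =
     (a * (f x).1 + (f y).1, a * (f x).2 + (f y).2)) ->
  exists a b c d, f = lmap a b c d.
Proof.
move=> H; have H0 : f (0, 0) = (0, 0).
  by have := H (-1) (0, 0) (0, 0); rewrite /= mulr0 addr0 !mulN1r !addNr.
exists (f (1, 0)).1, (f (0, 1)).1, (f (1, 0)).2, (f (0, 1)).2.
apply/funext => -[x y].
have := H y (0, 1) (0, 0); have := H x (1, 0) (0, y).
rewrite /= H0 /= !mulr0 !mulr1 !addr0 !add0r => -> ->.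
by rewrite /lmap /=; congr pair; ring.
Qed.

(* Any linear coordinate system of a plane may replace the one given by the basis. *)
Lemma body_linear_coords U (f : U -> R * R) (L : set U) : \dim {:U} = 2%N ->
  (forall (a : R) x y, f (a *: x + y) = (a * (f x).1 + (f y).1, a * (f x).2 + (f y).2)) ->
  bijective f -> body (f @` L) <-> body (plane U @^-1` L).
Proof.
move=> e fl [g K1 K2]; have [co C1 C2] := plane_bij e.
have pl (a : R) x y : plane U (a * x.1 + y.1, a * x.2 + y.2) = a *: plane U x + plane U y.
  by rewrite !planeE /= !scalerDl scalerDr !scalerA addrACA.
have [a1 [b1 [c1 [d1 E1]]]] : exists a b c d, f \o plane U = lmap a b c d.
  by apply: linear_lmap => a x y; rewrite /= pl fl.
have [a2 [b2 [c2 [d2 E2]]]] : exists a b c d, co \o g = lmap a b c d.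
  apply: linear_lmap => a x y; apply: (can_inj C1); rewrite pl /= !C2.
  by apply: (can_inj K1); rewrite fl !K2.
split=> bL.
  rewrite (_ : _ @^-1` L = lmap a2 b2 c2 d2 @` (f @` L)); first exact: body_lmap.
  rewrite -E2; apply/seteqP; split => [z Lz|_ [_ [x Lx <-] <-]] /=.
    by exists (f (plane U z)); [exists (plane U z)|rewrite /= K1 C1].
  by rewrite K1 C2.
rewrite (_ : f @` L = lmap a1 b1 c1 d1 @` (plane U @^-1` L)); first exact: body_lmap.
rewrite -E1; apply/seteqP; split => [_ [x Lx <-]|_ [z Lz <-]] /=.
  by exists (co x); rewrite /= C2.
by exists (plane U z).
Qed.

End VectorCoordinates.

(** * The unit ball of a norm is a symmetric body of positive area *)

Section NormBall.
Context {R : realType}.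
Variables (U : vectType R) (N : U -> R).
Hypotheses (e : \dim {:U} = 2%N) (nN : is_norm N).

Notation mu := (@lebesgue_measure R).

Let F z := N (plane U z).

Let N_eq0 x : N x = 0 -> x = 0. Proof. by have [H _ _] := nN; exact: H. Qed.
Let NZ (a : R) x : N (a *: x) = `|a| * N x. Proof. by have [_ H _] := nN; exact: H. Qed.
Let ND x y : N (x + y) <= N x + N y. Proof. by have [_ _ H] := nN; exact: H. Qed.

Let N0 : N 0 = 0. Proof. by rewrite -(scale0r (0 : U)) NZ normr0 mul0r. Qed.

Let NN x : N (- x) = N x. Proof. by rewrite -scaleN1r NZ normrN1 mul1r. Qed.

Let N_ge0 x : 0 <= N x.
Proof. by have := ND x (- x); rewrite subrr N0 NN; lra. Qed.

Let planeB z w : plane U (z.1 - w.1, z.2 - w.2) = plane U z - plane U w.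
Proof. by rewrite !planeE /= !scalerBl opprD addrACA. Qed.

Let F_le z : F z <= `|z.1| * N (basis_vec U 0) + `|z.2| * N (basis_vec U 1).
Proof. by rewrite /F planeE (le_trans (ND _ _))// !NZ. Qed.

Let F_continuous : continuous F.
Proof.
move=> z; pose G w := `|w.1 - z.1| * N (basis_vec U 0) + `|w.2 - z.2| * N (basis_vec U 1).
have cG : G w @[w --> z] --> (0 : R).
  have -> : 0 = `|z.1 - z.1| * N (basis_vec U 0) + `|z.2 - z.2| * N (basis_vec U 1).
    by rewrite !subrr normr0 !mul0r addr0.
  apply: cvgD; apply: cvgM; try exact: cvg_cst.
    by apply: cvg_norm; apply: cvgB; [exact: cvg_fst|exact: cvg_cst].
  by apply: cvg_norm; apply: cvgB; [exact: cvg_snd|exact: cvg_cst].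
apply: (@squeeze_cvgr _ _ _ _ (fun w => F z - G w) (fun w => F z + G w)).
- apply: nearW => w.
  have h1 : F w <= F z + G w.
    rewrite (le_trans _ (lerD (lexx _) (F_le (w.1 - z.1, w.2 - z.2))))// /F planeB.
    by rewrite -[X in N X <= _](subrK (plane U z)) addrC ND.
  have h2 : F z <= F w + G w.
    rewrite (le_trans _ (lerD (lexx _) (F_le (w.1 - z.1, w.2 - z.2))))// /F planeB.
    by rewrite -(NN (_ - _)) opprB -[X in N X <= _](subrK (plane U w)) addrC ND.
  by apply/andP; split; lra.
- by rewrite -[X in _ --> X]subr0; apply: cvgB => //; exact: cvg_cst.
- by rewrite -[X in _ --> X]addr0; apply: cvgD => //; exact: cvg_cst.
Qed.

Let plane0 : plane U (0, 0) = 0.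
Proof. by rewrite planeE !scale0r addr0. Qed.

Let planeZ (t : R) z : plane U (t * z.1, t * z.2) = t *: plane U z.
Proof. by rewrite !planeE scalerDr !scalerA. Qed.

(** [m] is the minimum of the norm on the Euclidean unit circle, positive by compactness;
    homogeneity extends the bound. It makes the unit ball bounded. *)
Let F_bounded_below : exists2 m, 0 < m & forall z, m * `|z.1| <= F z /\ m * `|z.2| <= F z.
Proof.
pose r z : R := z.1 ^+ 2 + z.2 ^+ 2.
have cr : continuous r.
  move=> z; apply: cvgD; apply: (continuous_comp _ (@exprn_continuous _ 2 _)).
    exact: continuous_fst.
  exact: continuous_snd.
pose S := [set z | r z = 1].
have S0 : S !=set0 by exists (1, 0); rewrite /S /r /= expr1n expr0n addr0.
have cS : compact S.
  apply: (@subclosed_compact _ _ (`[(-1 : R), 1]%classic `*` `[(-1 : R), 1]%classic)).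
  - apply: (preimage_closed (f := r) (D := [set 1])) => [z _|]; first exact: cr.
    exact: closed_eq.
  - by apply: compact_setX; exact: segment_compact.
  - move=> z; rewrite /S /r /= => h; split; rewrite /= in_itv /= -ler_norml -sqr_le_norm// expr1n.
      by have := sqr_ge0 z.2; lra.
    by have := sqr_ge0 z.1; lra.
have [z0 /set_mem Sz0 minF] := compact_EVT_min S0 cS (continuous_subspaceT F_continuous).
have m0 : 0 < F z0.
  rewrite lt_neqAle N_ge0 andbT eq_sym; apply/eqP => /N_eq0 z00.
  have [co K1 K2] := plane_bij e.
  have : z0 = (0, 0) by rewrite -(K1 z0) z00 -plane0 K1.
  by move=> z0E; move: Sz0; rewrite z0E /S /r /= !expr0n addr0 => /eqP; rewrite eq_sym oner_eq0.
exists (F z0) => // z.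
have r0 : 0 <= r z by rewrite addr_ge0 ?sqr_ge0.
have [rz0|rz0] := eqVneq (r z) 0.
  move: rz0 => /eqP; rewrite paddr_eq0 ?sqr_ge0// !sqrf_eq0 => /andP[/eqP -> /eqP ->].
  by rewrite normr0 mulr0; split; exact: N_ge0.
pose s := Num.sqrt (r z).
have s0 : 0 < s by rewrite sqrtr_gt0 lt_neqAle eq_sym rz0.
have ss : s ^+ 2 = r z by rewrite sqr_sqrtr.
have SZ : S (s^-1 * z.1, s^-1 * z.2).
  rewrite /S /r /= !exprMn -mulrDr exprVn ss mulVf//.
have := minF _ (mem_set SZ).
rewrite {2}/F planeZ NZ gtr0_norm ?invr_gt0// -ler_pdivrMl ?invr_gt0// invrK mulrC => h.
by split; apply: le_trans h; rewrite ler_wpM2l ?N_ge0// -sqr_le_norm ?(ltW s0)// ss;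
  rewrite /r ?lerDl ?lerDr sqr_ge0.
Qed.

Let B := plane U @^-1` unit_ball N.

Lemma body_unit_ball : body B.
Proof.
split; first by exists (0, 0); rewrite /B /unit_ball /= plane0 N0.
  have [m m0 H] := F_bounded_below.
  apply: (@subclosed_compact _ _ (`[- m^-1, m^-1]%classic `*` `[- m^-1, m^-1]%classic)).
  - apply: (preimage_closed (f := F) (D := [set x | x <= 1])) => [z _|]; first exact: F_continuous.
    exact: closed_le.
  - by apply: compact_setX; exact: segment_compact.
  - move=> z; rewrite /B /unit_ball /= => h; have [h1 h2] := H z.
    have inv (x : R) : m * x <= F z -> x <= m^-1.
      by move=> mx; rewrite -[m^-1]mulr1 ler_pdivlMl// (le_trans mx).
    by split; rewrite /= in_itv /= -ler_norml inv.
move=> x y t Bx By /andP[t0 t1]; rewrite /B /unit_ball /= plane_comb.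
rewrite (le_trans (ND _ _))// !NZ !ger0_norm// ?subr_ge0//.
have h1 : t * N (plane U x) <= t by rewrite ler_piMr.
have h2 : (1 - t) * N (plane U y) <= 1 - t by rewrite ler_piMr// subr_ge0.
by lra.
Qed.

Lemma centered_unit_ball : centered B.
Proof.
move=> x y; rewrite /B /unit_ball /= => h.
by rewrite (_ : plane U _ = - plane U (x, y)) ?NN// !planeE /= !scaleNr opprD.
Qed.

(** By the triangle inequality the ball contains the square with side [[0, C^-1]]; the summand 1
    makes [C] positive at once. *)
Lemma area_unit_ball_gt0 : 0 < area B.
Proof.
pose C := 1 + N (basis_vec U 0) + N (basis_vec U 1).
have C0 : 0 < C by rewrite /C -addrA ltr_pwDl// addr_ge0.
have bB := body_unit_ball.
have Q : (mu \x mu)%E (`[0, C^-1]%classic `*` `[0, C^-1]%classic) = (C^-1 * C^-1)%:E.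
  rewrite product_measure1E; try exact: measurable_itv.
  rewrite EFinM; congr (_ * _)%E; rewrite -[X in _ = X%:E]subr0; apply: lebesgue_measure_segment;
    by rewrite invr_ge0 ltW.
rewrite -lte_fin areaE// (@lt_le_trans _ _ (C^-1 * C^-1)%:E)//.
  by rewrite lte_fin mulr_gt0 ?invr_gt0.
rewrite -Q; apply: le_measure; rewrite ?inE.
- by apply: measurableX; exact: measurable_itv.
- exact: measurable_body.
move=> z [/= ]; rewrite !in_itv /= => /andP[z1 z1C] /andP[z2 z2C].
rewrite /B /unit_ball /= (le_trans (F_le z))// !ger0_norm//.
have h1 : z.1 * N (basis_vec U 0) <= C^-1 * N (basis_vec U 0) by rewrite ler_wpM2r.
have h2 : z.2 * N (basis_vec U 1) <= C^-1 * N (basis_vec U 1) by rewrite ler_wpM2r.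
have h3 : C^-1 + C^-1 * N (basis_vec U 0) + C^-1 * N (basis_vec U 1) = 1.
  by rewrite -[X in X + _ + _]mulr1 -!mulrDr -/C mulVf ?gt_eqF.
have h4 : 0 < C^-1 by rewrite invr_gt0.
by lra.
Qed.

End NormBall.

(** * Volume forms and mixed volumes in a plane *)

Section VolumeForms.
Context {R : realType}.
Variables (U : vectType R) (Om : ('I_2 -> U) -> R).
Hypotheses (e : \dim {:U} = 2%N) (vOm : volume_form Om).

Notation mu := (@lebesgue_measure R).

Let d := Om (fun i : 'I_2 => basis_vec U i).

Let pair2 (x y : U) : 'I_2 -> U := fun i => if i == ord0 then x else y.

Let ord2P (i : 'I_2) : i = ord0 \/ i = ord_max.
Proof. by case: i => [[|[|//]] hi]; [left|right]; apply/val_inj. Qed.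

Let pair2E (v : 'I_2 -> U) : v = pair2 (v ord0) (v ord_max).
Proof.
by apply/funext => i; have [->|->] := ord2P i.
Qed.

Let Om_basis : Om (pair2 (basis_vec U 0) (basis_vec U 1)) = d.
Proof. by rewrite /d [in RHS](pair2E (fun i : 'I_2 => basis_vec U i)). Qed.

Let Om_l (a : R) x x' y : Om (pair2 (a *: x + x') y) = a * Om (pair2 x y) + Om (pair2 x' y).
Proof.
have [H _ _] := vOm; have E z : pair2 z y = update (pair2 x y) ord0 z.
  by apply/funext => i; rewrite /update /pair2; case: eqP.
by rewrite (E (_ + _)) H -!E.
Qed.

Let Om_r (a : R) x y y' : Om (pair2 x (a *: y + y')) = a * Om (pair2 x y) + Om (pair2 x y').
Proof.
have [H _ _] := vOm; have E z : pair2 x z = update (pair2 x y) ord_max z.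
  by rewrite [RHS]pair2E /update /pair2 /=.
by rewrite (E (_ + _)) H -!E.
Qed.

Let Om_alt x : Om (pair2 x x) = 0.
Proof. by have [_ H _] := vOm; apply: (H _ ord0 ord_max). Qed.

Let Om_anti x y : Om (pair2 x y) = - Om (pair2 y x).
Proof.
have := Om_alt (1 *: x + y).
by rewrite Om_l !Om_r !Om_alt !mul1r; lra.
Qed.

Let Om_r2 x y y' (b b' : R) :
  Om (pair2 x (b *: y + b' *: y')) = b * Om (pair2 x y) + b' * Om (pair2 x y').
Proof.
have Om0 : Om (pair2 x 0) = 0.
  by have := Om_r 1 x 0 0; rewrite scaler0 addr0; lra.
by rewrite Om_r; congr (_ + _); rewrite -[b' *: y']addr0 Om_r Om0 addr0.
Qed.

Lemma volume_form_det z w : Om (fun i => if i == ord0 then plane U z else plane U w) =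
  d * (z.1 * w.2 - z.2 * w.1).
Proof.
rewrite -/(pair2 _ _) [plane U w]planeE Om_r2 !(Om_anti (plane U z)) planeE !Om_r2 !Om_alt.
by rewrite (Om_anti (basis_vec U 1)) Om_basis; ring.
Qed.

Lemma volume_form_neq0 : d != 0.
Proof.
apply/eqP => d0; have [_ _ [v /eqP]] := vOm; apply.
have [co K1 K2] := plane_bij e.
rewrite (pair2E v) -(K2 (v ord0)) -(K2 (v ord_max)).
by rewrite [LHS](volume_form_det (co (v ord0)) (co (v ord_max))) d0 mul0r.
Qed.

Lemma volE A : body (plane U @^-1` A) -> vol Om A = `|d| * area (plane U @^-1` A).
Proof.
by move=> bA; rewrite /vol lebesgue_rV2E//; exact: measurable_body.
Qed.

Lemma mixed_volumeE L B : body (plane U @^-1` L) -> body (plane U @^-1` B) ->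
  mixed_volume1 Om L B = `|d| / 2 * mixed (plane U @^-1` L) (plane U @^-1` B).
Proof.
move=> bL bB; pose K := fun i : 'I_2 => if i == ord_max then B else L.
have S1 : minkowski_sum K [set ord0]%SET = L.
  apply/seteqP; split => [_ [y Ky ->]|x Lx].
    by rewrite big_set1; have := Ky ord0; rewrite inE eqxx => /(_ isT).
  exists (fun=> x); last by rewrite big_set1.
  by move=> i; rewrite inE => /eqP ->.
have S2 : minkowski_sum K [set ord_max]%SET = B.
  apply/seteqP; split => [_ [y Ky ->]|x Bx].
    by rewrite big_set1; have := Ky ord_max; rewrite inE eqxx => /(_ isT).
  exists (fun=> x); last by rewrite big_set1.
  by move=> i; rewrite inE => /eqP ->.
have S3 : plane U @^-1` minkowski_sum K [set: 'I_2]%SET =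
    msum (plane U @^-1` L) (plane U @^-1` B).
  have pD (x y : R * R) : plane U (x.1 + y.1, x.2 + y.2) = plane U x + plane U y.
    by rewrite !planeE /= !scalerDl addrACA.
  have [co K1 K2] := plane_bij e.
  have sum2 (y : 'I_2 -> U) : \sum_(i in [set: 'I_2]%SET) y i = y ord0 + y ord_max.
    rewrite (eq_bigl xpredT) => [|i]; last by rewrite inE.
    by rewrite big_ord_recl big_ord1; congr (_ + y _); apply/val_inj.
  apply/seteqP; split => [z [y Ky zE]|_ [x [y [Lx By ->]]]].
    exists (co (y ord0)), (co (y ord_max)); split.
    - by rewrite /= K2; apply: (Ky ord0); rewrite inE.
    - by rewrite /= K2; apply: (Ky ord_max); rewrite inE.
    - by apply: (can_inj K1); rewrite pD !K2 zE sum2.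
  exists (pair2 (plane U x) (plane U y)); last by rewrite sum2 /= pD.
  by move=> i _; have [->|->] := ord2P i.
have bS : body (plane U @^-1` minkowski_sum K [set: 'I_2]%SET) by rewrite S3; exact: body_msum.
rewrite /mixed_volume1 /mixed_volume -/K.
(* The non-empty index sets are the full one, with sign [+], and the two singletons, with sign
   [-]. *)
rewrite (bigD1 [set: 'I_2]%SET) /=; last by apply/eqP/setP => /(_ ord0); rewrite !inE.
rewrite (bigD1 [set ord0]%SET) /=; last first.
  apply/andP; split; apply/eqP/setP; first by move=> /(_ ord0); rewrite !inE.
  by move=> /(_ ord_max); rewrite !inE.
rewrite (bigD1 [set ord_max]%SET) /=; last first.
  apply/andP; split; [apply/andP; split|]; apply/eqP/setP.
  - by move=> /(_ ord_max); rewrite !inE.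
  - by move=> /(_ ord0); rewrite !inE.
  - by move=> /(_ ord0); rewrite !inE.
rewrite big1 => [|S]; last first.
  have ex (T : {set 'I_2}) : S = T <->
      (ord0 \in S) = (ord0 \in T) /\ (ord_max \in S) = (ord_max \in T).
    split=> [->//|[h1 h2]]; apply/setP => i.
    by have [->|->] := ord2P i.
  move=> /andP[/andP[/andP[/eqP n0 /eqP n1] /eqP n2] /eqP n3].
  case h1 : (ord0 \in S); case h2 : (ord_max \in S).
  - by case: n1; apply/ex; rewrite h1 h2 !inE.
  - by case: n2; apply/ex; rewrite h1 h2 !inE.
  - by case: n3; apply/ex; rewrite h1 h2 !inE.
  - by case: n0; apply/ex; rewrite h1 h2 !inE.
rewrite cardsT card_ord !cards1 S1 S2 (volE bS) (volE bL) (volE bB) S3 /mixed.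
rewrite subnn expr0 subSnn expr1 (_ : 2`!%:R = 2 :> R)//.
by field.
Qed.

End VolumeForms.

(** * Projection bodies and dual volume *)

Section Projections.
Context {R : realType}.
Variables (U : vectType R) (Om : ('I_2 -> U) -> R).
Hypotheses (e : \dim {:U} = 2%N) (vOm : volume_form Om).

Notation mu := (@lebesgue_measure R).

Let d := Om (fun i : 'I_2 => basis_vec U i).

(** The covector [(- (d * q), d * p)] is [Om(v, .)]. It vanishes on [v], so it factors through the
    quotient line, where it multiplies the coordinate along [c] by [D]. Thus [|D|] times the length
    of the image of [L] is the length of the interval of values of [Om(v, .)] on [L]. *)
Lemma quotient_image_volume p q L : plane U (p, q) != 0 -> body (plane U @^-1` L) ->
  vol (@Defs.contract R 1 U Om (plane U (p, q))) (@quotient_image R U (plane U (p, q)) L) =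
  width (- (d * q)) (d * p) (plane U @^-1` L).
Proof.
set v := plane U (p, q) => v0 bL; have [co K1 K2] := plane_bij e.
have dQ : \dim {:quotient_line v} = 1%N.
  by rewrite dimvf /dim /= dimv_compl e dim_vline v0.
have [cQ Q1 Q2] := of_coords_bij dQ.
have QE x : of_coords (quotient_line v) (row1 x) = x *: basis_vec (quotient_line v) 0.
  by rewrite /of_coords big_ord1 mxE.
pose c := vsval (basis_vec (quotient_line v) 0).
have QcE x : vsval (of_coords (quotient_line v) (row1 x)) = x *: c by rewrite QE linearZ.
have dec u : exists x t, u = x *: c + t *: v.
  have : u \in (<[v]> + <[v]>^C)%VS by rewrite addv_complf memvf.
  move=> /memv_addP[_ /vlineP[t ->] [b bC ->]].
  exists (cQ (vsproj _ b) 0 ord0), t; rewrite addrC; congr (_ + _).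
  rewrite -QcE (_ : row1 _ = cQ (vsproj (<[v]>^C)%VS b)); first by rewrite Q2 vsprojK.
  by apply/rowP => i; rewrite mxE (ord1 i).
pose D := pairing (- (d * q)) (d * p) (co c).
have OmE (u : 'I_1 -> quotient_line v) :
    @Defs.contract R 1 U Om v u = pairing (- (d * q)) (d * p) (co (vsval (u ord0))).
  have := volume_form_det vOm (p, q) (co (vsval (u ord0))).
  rewrite K2 -/v -/d /pairing /= => E.
  rewrite (_ : - _ * _ + _ = d * (p * (co (vsval (u ord0))).2 - q * (co (vsval (u ord0))).1));
    last by ring.
  rewrite -E /Defs.contract; congr Om; apply/funext => i.
  case: unliftP => [j ->|->]; last by rewrite eqxx.
  by rewrite (ord1 j).
have coE x t : pairing (- (d * q)) (d * p) (co (x *: c + t *: v)) = x * D.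
  have -> : co (x *: c + t *: v) = (x * (co c).1 + t * p, x * (co c).2 + t * q).
    apply: (can_inj K1); rewrite K2 planeE /= -{1}[c](K2 c) /v !planeE /=.
    by rewrite !scalerDr !scalerA !scalerDl addrACA.
  by rewrite /D /pairing /=; ring.
(* Otherwise [Om(v, .)] would vanish on [c] and on [v], hence everywhere, forcing [v = 0]. *)
have D0 : D != 0.
  have d0 := volume_form_neq0 e vOm; rewrite -/d in d0.
  apply/eqP => D0.
  have Z z : pairing (- (d * q)) (d * p) z = 0.
    by have [x [t E]] := dec (plane U z); rewrite -(K1 z) E coE D0 mulr0.
  have q0 : q = 0.
    have := Z (1, 0); rewrite /pairing /= mulr1 mulr0 addr0 => /eqP.
    by rewrite oppr_eq0 mulf_eq0 (negPf d0) => /eqP.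
  have p0 : p = 0.
    have := Z (0, 1); rewrite /pairing /= mulr1 mulr0 add0r => /eqP.
    by rewrite mulf_eq0 (negPf d0) => /eqP.
  by move/eqP: v0; apply; rewrite /v p0 q0 planeE !scale0r addr0.
have [[i j] /= ij E] := body_pairing (- (d * q)) (d * p) bL.
have SE : row1 @^-1` (of_coords (quotient_line v) @^-1` @quotient_image R U v L) =
    (fun x => D * x + 0) @^-1` `[i, j]%classic.
  rewrite -E; apply/seteqP; split => [x [t Lt]|x [z Lz zx]].
    exists (co (x *: c + t *: v)); first by rewrite /= K2 -QcE.
    by rewrite coE; ring.
  have [y [t yt]] := dec (plane U z).
  have xy : y = x.
    by apply: (mulIf D0); rewrite -(coE y t) -yt K1 zx; ring.
  by exists t; rewrite QcE -xy -yt.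
rewrite /vol lebesgue_rV1E SE; last first.
  by rewrite -[X in measurable X]setTI; apply: measurable_affine.
have := @lebesgue_measure_affine R D 0 `[i, j]%classic D0 (measurable_itv _).
rewrite lebesgue_measure_segment// => mE.
have w0 : width (- (d * q)) (d * p) (plane U @^-1` L) = j - i.
  rewrite /width E; congr (_ - _).
    by apply: sup_max => [|x]; rewrite /= in_itv /= ?ij ?lexx// => /andP[].
  by apply: inf_min => [|x]; rewrite /= in_itv /= ?ij ?lexx// => /andP[].
rewrite OmE -/c -/D w0 -[RHS]/(fine (j - i)%:E) mE.
(* [fine] commutes with the product for a finite measure; [mE] excludes infinite values. *)
case: (mu _) mE => [r|+|+] //=.
- by rewrite gt0_muley ?lte_fin ?normr_gt0.
- by rewrite gt0_muleNy ?lte_fin ?normr_gt0.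
Qed.

Definition eval_basis (f : dual_space U) : R * R := (f (basis_vec U 0), f (basis_vec U 1)).

Lemma eval_basisE (f : dual_space U) z : f (plane U z) = pairing z.1 z.2 (eval_basis f).
Proof. by rewrite planeE linearD !linearZ. Qed.

Lemma dim_dual : \dim {:dual_space U} = 2%N.
Proof. by rewrite dimvf -[RHS]e dimvf; exact: muln1. Qed.

Lemma eval_basis_bij : bijective eval_basis.
Proof.
have [co K1 K2] := plane_bij e.
have ex z : exists f, eval_basis f = z.
  pose X := [:: basis_vec U 0; basis_vec U 1].
  have [g Hg] := linear_of_free X ([:: z.1; z.2] : seq R^o).
  have XE : X = vbasis {:U}.
    apply: (@eq_from_nth _ 0); first by rewrite (size_tuple (vbasis {:U})) e.
    by move=> [|[|]].
  have fX : free X by rewrite XE; exact/basis_free/vbasisP.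
  have := Hg fX erefl => -[g0 g1].
  by exists (linfun g); rewrite /eval_basis !lfunE /= g0 g1; case: (z).
pose g z := projT1 (cid (ex z)).
have gK z : eval_basis (g z) = z by exact: projT2 (cid (ex z)).
exists g => // f; apply/lfunP => u; rewrite -(K2 u) !eval_basisE gK.
by [].
Qed.

Lemma convex_body_dual (P : set (dual_space U)) :
  convex_body P <-> body (eval_basis @` P).
Proof.
rewrite (convex_bodyE _ dim_dual); apply: iff_sym; apply: body_linear_coords.
- exact: dim_dual.
- by move=> a f g; rewrite /eval_basis !add_lfunE !scale_lfunE.
- exact: eval_basis_bij.
Qed.

Lemma dual_volE (P : set (dual_space U)) : body (eval_basis @` P) ->
  dual_vol Om P = `|d|^-1 * area (eval_basis @` P).
Proof.
move=> bP; rewrite /dual_vol.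
set S := [set _ | _]; have SE : row2 @^-1` S = eval_basis @` P.
  apply/seteqP; split => [[x y] [f Pf fx]|_ [f Pf <-]].
    exists f => //; rewrite /eval_basis.
    by have := fx ord0; have := fx ord_max; rewrite !mxE /= => -> ->.
  by exists f => // -[[|[|//]] hi]; rewrite mxE.
by rewrite lebesgue_rV2E SE//; exact: measurable_body.
Qed.

(** The prescribed support function at [v] is that of [L - L] at the covector [Om(v, .)], and
    [lmap 0 d (- d) 0] is the transpose of [v |-> Om(v, .)]. One direction evaluates any competitor,
    the other produces the extremal one. *)
Lemma projection_bodyE L (P : set (dual_space U)) : body (plane U @^-1` L) ->
  is_projection_body Om L P <->
  eval_basis @` P = lmap 0 d (- d) 0 @` difference_body (plane U @^-1` L).
Proof.
move=> bL; set D := difference_body _.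
have bD : body D by exact: body_difference.
have d0 := volume_form_neq0 e vOm; rewrite -/d in d0.
have bJ := body_lmap 0 d (- d) 0 bD.
have supJ p q : sup (pairing p q @` (lmap 0 d (- d) 0 @` D)) =
    width (- (d * q)) (d * p) (plane U @^-1` L).
  rewrite -sup_difference_body// -/D image_comp; congr sup; congr image.
  by apply/funext => z; rewrite /pairing /lmap /=; ring.
have supP p q : [set f (plane U (p, q)) | f in P] = pairing p q @` (eval_basis @` P).
  by rewrite image_comp; apply: eq_imagel => f _; rewrite /= eval_basisE.
split=> [[/convex_body_dual bP H]|PE].
  have E p q : (p, q) != (0, 0) -> sup (pairing p q @` (eval_basis @` P)) =
      sup (pairing p q @` (lmap 0 d (- d) 0 @` D)).
    move=> pq0; have nz : plane U (p, q) != 0.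
      rewrite -[X in _ != X](_ : plane U (0, 0) = 0); last by rewrite planeE !scale0r addr0.
      by rewrite (inj_eq (bij_inj (plane_bij e))).
    by rewrite supJ -quotient_image_volume// -H// supP.
  by apply/seteqP; split; apply: sub_body => // p q pq0; rewrite E.
split; first by apply/convex_body_dual; rewrite PE.
have [co K1 K2] := plane_bij e.
move=> v; rewrite -(K2 v); case: (co v) => p q v0.
by rewrite supP PE supJ quotient_image_volume.
Qed.

End Projections.

(** * The value of the functional in a plane, and induced densities *)

Section PlaneInvariant.
Context {R : realType}.

Lemma preimage_image_bij (T T' : Type) (f : T -> T') (A : set T) :
  bijective f -> f @^-1` (f @` A) = A.
Proof.
move=> bf; apply/seteqP; split => [x [y Ay /(bij_inj bf) <-]//|x Ax].
by exists x.
Qed.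

Lemma image_preimage_bij (T T' : Type) (f : T -> T') (A : set T') :
  bijective f -> f @` (f @^-1` A) = A.
Proof.
move=> [g K1 K2]; apply/seteqP; split => [_ [x Ax <-]//|y Ay].
by exists (g y); rewrite /= K2.
Qed.

Section Plane.
Variables (U : vectType R) (Om : ('I_2 -> U) -> R) (N : U -> R).
Hypotheses (e : \dim {:U} = 2%N) (vOm : volume_form Om) (nN : is_norm N).

Let d := Om (fun i : 'I_2 => basis_vec U i).
Let B := plane U @^-1` unit_ball N.

Let d0 : d != 0. Proof. exact: volume_form_neq0. Qed.
Let bB : body B. Proof. exact: body_unit_ball. Qed.
Let sB : centered B. Proof. exact: centered_unit_ball. Qed.
Let B0 : 0 < area B. Proof. exact: area_unit_ball_gt0. Qed.
Let pd : 0 < `|d|. Proof. by rewrite normr_gt0. Qed.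

Let svolE L (P : set (dual_space U)) : convex_body L -> is_projection_body Om L P ->
  svol Om (unit_ball N) P = d ^+ 2 * (area B * area (difference_body (plane U @^-1` L))).
Proof.
move=> cL pP; have bL : body (plane U @^-1` L) by exact/convex_bodyE.
have /(projection_bodyE e vOm P bL) PE := pP.
have bD := body_difference bL.
rewrite /svol volE// -/B dual_volE// PE; last exact: body_lmap.
rewrite area_linear_antidiagonal// -/d mulrACA mulfV ?gt_eqF// mul1r; ring.
Qed.

(** Since [mixed] is twice the mixed area, the constraint reads [|d| * mixed = 2]; the bound is the
    square of this 2. *)
Let svol_le4 L (P : set (dual_space U)) : convex_body L ->
  mixed_volume1 Om L (unit_ball N) = 1 -> is_projection_body Om L P ->
  svol Om (unit_ball N) P <= 4.
Proof.
move=> cL; have bL : body (plane U @^-1` L) by exact/convex_bodyE.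
rewrite mixed_volumeE// -/B -/d => M1 pP; rewrite (svolE cL pP).
have M2 : `|d| * mixed (plane U @^-1` L) B = 2 by lra.
have -> : 4 = d ^+ 2 * mixed (plane U @^-1` L) B ^+ 2.
  by rewrite -[d ^+ 2]real_normK ?num_real// -exprMn M2; ring.
by rewrite ler_wpM2l ?sqr_ge0//; exact: mixed_difference_body.
Qed.

(* The bound is attained by the multiple of the unit ball satisfying the constraint. *)
Let svol_eq4 : exists L P, [/\ convex_body L, mixed_volume1 Om L (unit_ball N) = 1,
  is_projection_body Om L P & 4 = svol Om (unit_ball N) P].
Proof.
(* The mixed volume of [c B] and [B] is [c] times the volume of [B], so this factor normalizes it to
   1. *)
pose c := (`|d| * area B)^-1.
have c0 : 0 < c by rewrite invr_gt0 mulr_gt0.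
have cE : c * (`|d| * area B) = 1 by rewrite mulVf// gt_eqF// mulr_gt0.
pose L := plane U @` (lmap c 0 0 c @` B).
have LE : plane U @^-1` L = lmap c 0 0 c @` B by exact/preimage_image_bij/plane_bij.
have bcB := body_lmap c 0 0 c bB.
have cL : convex_body L by apply/convex_bodyE => //; rewrite LE.
pose P := eval_basis (U := U) @^-1` (lmap 0 d (- d) 0 @` difference_body (plane U @^-1` L)).
have pP : is_projection_body Om L P.
  apply/projection_bodyE => //; first by rewrite LE.
  exact/image_preimage_bij/eval_basis_bij.
exists L, P; split => //.
  by rewrite mixed_volumeE ?LE// -/B -/d mixed_dilation//; lra.
rewrite (svolE cL pP) LE difference_body_dilation// area_dilation ?mulr_gt0//.
rewrite -[d ^+ 2]real_normK ?num_real//.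
have -> : `|d| ^+ 2 * (area B * ((2 * c) ^+ 2 * area B)) = 4 * (c * (`|d| * area B)) ^+ 2 by ring.
by rewrite cE expr1n mulr1.
Qed.

Lemma calV_unit_ball : calV Om (unit_ball N) = (omega R 2)%:E.
Proof.
rewrite /calV; set S := [set _ | _].
have -> : ereal_sup [set s%:E | s in S] = 4%:E.
  apply: le_anti; apply/andP; split.
    apply: ge_ereal_sup => _ [s [L [P [cL M1 pP ->]]] <-].
    by rewrite lee_fin; exact: svol_le4 M1 pP.
  apply: ereal_sup_ubound; exists 4 => //.
(* The prefactor is [omega_2 / omega_1^2 = omega_2 / 4], which cancels the supremum 4; the value of
   [omega_2] is not involved. *)
rewrite -EFinM omega1 expr1; congr EFin.
by rewrite -natrX; field.
Qed.

End Plane.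

(** As [(v, w)] is a factorization, the choice in [factors] does not fall back on its default and
    returns vectors with the same wedge; if they were dependent, this wedge would be zero. *)
Lemma span2_dim (W : vectType R) (v w : W) : wedge v w <> wedge 0 0 ->
  \dim (span2 (wedge v w)) = 2%N.
Proof.
rewrite /span2 => nz; have [p [q [-> E]]] : exists p q, factors (wedge v w) = (p, q) /\
    wedge v w = wedge p q.
  have : wedge v w = wedge (factors (wedge v w)).1 (factors (wedge v w)).2.
    have ex : exists p : W * W, [set p | wedge v w = wedge p.1 p.2] p by exists (v, w).
    exact: (xgetPex (0, 0) ex).
  by case: factors => p q; exists p, q.
rewrite E in nz => {E v w} /=.
have /eqP : free [:: p; q]; last by [].
rewrite free_cons seq1_free; apply/andP; split.
  rewrite span_seq1; apply/negP => /vlineP[k pE]; apply: nz.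
  have fk (f : dual_space W) : f (k *: q) = k * f q by rewrite linearZ.
  by apply/funext => f; apply/funext => g; rewrite /wedge pE !fk !linear0; ring.
apply/eqP => q0; apply: nz.
by apply/funext => f; apply/funext => g; rewrite /wedge q0 !linear0 /=; ring.
Qed.

End PlaneInvariant.

Theorem corollary6p2 (R : realType) :
  (forall (V : vectType R) (Om : ('I_2 -> V) -> R) (N : V -> R),
     \dim {:V} = 2%N -> volume_form Om -> is_norm N ->
     calV Om (unit_ball N) = (omega R 2)%:E /\ omega R 2 = pi) /\
  (forall (W : vectType R) (N : W -> R)
          (Om : forall P : {vspace W}, ('I_2 -> subvs_of P) -> R),
     (2 <= \dim {:W})%N -> is_norm N ->
     (forall P : {vspace W}, \dim P = 2%N -> volume_form (Om P)) ->
     forall v w : W,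
       density2 calV Om N (wedge v w) = density2 busemann Om N (wedge v w)).
Proof.
split=> [V Om N e vOm nN|W N Om _ nN vOm v w].
  by split; [exact: calV_unit_ball|exact: omega2].
rewrite /density2; case: asboolP => // nz; have dP := span2_dim nz.
(* On a non-zero 2-vector the densities differ only in the value of the functional at the ball of
   the restricted norm; what remains is that the span is a plane, with a volume form and a norm. *)
rewrite /volume_of calV_unit_ball//.
- by rewrite dimvf.
- exact: vOm.
have [N0 NZ ND] := nN; split.
- by move=> x /N0 x0; apply: (can_inj vsvalK); rewrite x0 linear0.
- by move=> a x; rewrite linearZ NZ.
- by move=> x y; rewrite linearD ND.
Qed.
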